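(* Let $\beta_1,\beta_2,\gamma_1,\gamma_2\in\mathbb{C}$ with $\beta_1\neq\beta_2$. With respect to the actual fundamental matrices $\Phi_\infty^\theta(x,0)$ at $x=\infty$, the initial equation has one singular direction at infinity, $\theta=\arg(\gamma_2-\gamma_1)$, and the corresponding Stokes matrix is $$St_\infty^\theta=\begin{pmatrix}1&2\pi i(\gamma_2-\gamma_1)S\\0&1\end{pmatrix},\qquad S=\sum_{n=0}^\infty\frac{(-1)^{n+1}(\gamma_2-\gamma_1)^n(\beta_2-\beta_1)^n}{n!\,(n+1)!}.$$
   Context: Initial equation: $L_2(L_1 y)=0$ with $L_1=\partial-\left(\frac{\beta_1}{x^2}+\gamma_1\right)$, $L_2=\partial-\left(-\frac{2}{x}+\frac{\beta_2}{x^2}+\gamma_2\right)$, $\partial=\frac{d}{dx}$. A fundamental matrix of it means a matrix $\begin{pmatrix}\Phi_1&\Phi_{12}\\0&\Phi_2\end{pmatrix}$ with $L_1\Phi_1=0$, $L_2\Phi_2=0$, $L_1\Phi_{12}=\Phi_2$ and $\Phi_1,\Phi_2\not\equiv0$. Put $G=\mathrm{diag}(\gamma_1,\gamma_2)$, $\Lambda=\mathrm{diag}(0,-2)$, $B=\mathrm{diag}(\beta_1,\beta_2)$. If $\gamma_1\neq\gamma_2$, then for a direction $\theta\neq\arg(\gamma_2-\gamma_1)$ (mod $2\pi$) the actual fundamental matrix at $\infty$ is $$\Phi_\infty^\theta(x,0)=e^{-B/x}\left(\tfrac1x\right)^{-\Lambda}P_\theta(x)\,e^{Gx},\quad P_\theta(x)=\begin{pmatrix}1&\frac{e^{-(\beta_2-\beta_1)/x}-1}{\beta_2-\beta_1}+\omega_\theta(x)\\0&1\end{pmatrix},$$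 $\omega_\theta(x)=\int_0^{+\infty e^{i\theta}}\frac{v(p)e^{-xp}}{1-\frac{p}{\gamma_2-\gamma_1}}\,dp$, $v(p)=\sum_{k\ge0}\frac{(-1)^k(\beta_2-\beta_1)^k}{k!(k+1)!}p^k$, defined for $\mathrm{Re}(xe^{i\theta})>|\beta_2-\beta_1|$. A direction is singular at infinity if the denominator $1-\frac{p}{\gamma_2-\gamma_1}$ of this Laplace integral vanishes on the ray $\arg p=\theta$. For a singular direction $\theta$ the Stokes matrix is $St_\infty^\theta=(\Phi_\infty^{\theta+\epsilon}(x,0))^{-1}\Phi_\infty^{\theta-\epsilon}(x,0)$, for small $\epsilon>0$ and $x$ in the common domain of definition. If $\gamma_1=\gamma_2$, there is a single actual fundamental matrix (with $\omega_\theta$ replaced by $0$), and the Stokes matrix is by convention the identity, in agreement with the formula. *)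

(* Defs.v *)
From Stdlib Require Import Reals ZArith.
From Coquelicot Require Import Coquelicot.

Open Scope C_scope.

Definition Cexp (z : C) : C := RtoC (exp (Re z)) * (cos (Im z), sin (Im z)).

Definition Cexpi (theta : R) : C := Cexp (Ci * RtoC theta).

Definition CSeries (a : nat -> C) : C :=
  iota (T := C_CompleteNormedModule) (fun s => is_series (V := C_NormedModule) a s).

Definition is_arg (z : C) (theta : R) : Prop :=
  z <> 0 /\ z = RtoC (Cmod z) * Cexpi theta.

Definition eq_mod_2PI (s t : R) : Prop :=
  exists k : Z, s = (t + 2 * IZR k * PI)%R.

Definition C22 : Type := @matrix C 2 2.

Definition mk22 (a b c d : C) : C22 :=
  mk_matrix 2 2 (fun i j =>
    match i, j with
    | O, O => a
    | O, _ => b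
    | _, O => c
    | _, _ => d
    end).

Definition diag22 (a d : C) : C22 := mk22 a 0 0 d.

Definition ent (M : C22) (i j : nat) : C := coeff_mat (0 : C) M i j.

Definition mul22 (M N : C22) : C22 := Mmult (T := C_Ring) M N.

Definition one22 : C22 := Mone (T := C_Ring).

Definition is_inverse (M N : C22) : Prop :=
  mul22 M N = one22 /\ mul22 N M = one22.

(* [L1 y = f] and [L2 y = f] on [D], written as [y' = a y + f] with a complex
   derivative. *)
Definition L1_eq (b1 g1 : C) (D : C -> Prop) (y f : C -> C) : Prop :=
  forall x, D x ->
    is_derive (K := C_AbsRing) (V := C_NormedModule) y x
      ((b1 / x ^ 2 + g1) * y x + f x).

Definition L2_eq (b2 g2 : C) (D : C -> Prop) (y f : C -> C) : Prop :=
  forall x, D x ->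
    is_derive (K := C_AbsRing) (V := C_NormedModule) y x
      ((- (2 / x) + b2 / x ^ 2 + g2) * y x + f x).

(* Fundamental matrix on [D] of the equation [L2 (L1 y) = 0]. *)
Definition is_fundamental_matrix (b1 b2 g1 g2 : C) (D : C -> Prop)
    (Phi : C -> C22) : Prop :=
  (forall x, D x -> ent (Phi x) 1 0 = 0) /\
  L1_eq b1 g1 D (fun x => ent (Phi x) 0 0) (fun _ => 0) /\
  L2_eq b2 g2 D (fun x => ent (Phi x) 1 1) (fun _ => 0) /\
  L1_eq b1 g1 D (fun x => ent (Phi x) 0 1) (fun x => ent (Phi x) 1 1) /\
  (exists x, D x /\ ent (Phi x) 0 0 <> 0) /\
  (exists x, D x /\ ent (Phi x) 1 1 <> 0).

Definition v (b1 b2 p : C) : C :=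
  CSeries (fun k =>
    (- (1)) ^ k * (b2 - b1) ^ k / RtoC (INR (fact k) * INR (fact (S k))) * p ^ k).

Definition laplace_denominator (g1 g2 p : C) : C := 1 - p / (g2 - g1).

(* The integrand of [omega] on the ray [p = r e^{i theta}], including the factor
   [e^{i theta}] from [dp = e^{i theta} dr]. *)
Definition laplace_integrand (b1 b2 g1 g2 : C) (theta : R) (x : C) (r : R) : C :=
  let p := RtoC r * Cexpi theta in
  v b1 b2 p * Cexp (- (x * p)) / laplace_denominator g1 g2 p * Cexpi theta.

Definition omega (b1 b2 g1 g2 : C) (theta : R) (x : C) : C :=
  if Ceq_dec g1 g2 then 0
  else RInt_gen (V := C_R_CompleteNormedModule)
         (laplace_integrand b1 b2 g1 g2 theta x)
         (at_point 0%R) (Rbar_locally p_infty).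

Definition P_inf (b1 b2 g1 g2 : C) (theta : R) (x : C) : C22 :=
  mk22 1 ((Cexp (- ((b2 - b1) / x)) - 1) / (b2 - b1) + omega b1 b2 g1 g2 theta x)
       0 1.

(* The second factor is [(1/x)^{-Lambda}] with [Lambda = diag(0, -2)]. *)
Definition Phi_inf (b1 b2 g1 g2 : C) (theta : R) (x : C) : C22 :=
  mul22 (mul22 (mul22
    (diag22 (Cexp (- (b1 / x))) (Cexp (- (b2 / x))))
    (diag22 ((1 / x) ^ 0) ((1 / x) ^ 2)))
    (P_inf b1 b2 g1 g2 theta x))
    (diag22 (Cexp (g1 * x)) (Cexp (g2 * x))).

Definition dom_inf (b1 b2 g1 g2 : C) (theta : R) (x : C) : Prop :=
  if Ceq_dec g1 g2 then x <> 0
  else (Cmod (b2 - b1) < Re (x * Cexpi theta))%R.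

Definition singular_direction_inf (g1 g2 : C) (theta : R) : Prop :=
  g1 <> g2 /\
  exists r : R, (0 < r)%R /\ laplace_denominator g1 g2 (RtoC r * Cexpi theta) = 0.

(* The existence clause makes the common domain nonempty, so that at most one [St]
   qualifies. When [g1 = g2] the Stokes matrix is the identity by convention. *)
Definition is_stokes_matrix_inf (b1 b2 g1 g2 : C) (theta : R) (St : C22) : Prop :=
  (g1 = g2 -> St = one22) /\
  (g1 <> g2 ->
   exists eps0 : R, (0 < eps0)%R /\
   forall eps : R, (0 < eps < eps0)%R ->
     let common x := dom_inf b1 b2 g1 g2 (theta + eps) x /\
                     dom_inf b1 b2 g1 g2 (theta - eps) x in
     (exists x, common x) /\
     forall x, common x ->
       exists N : C22,
         is_inverse (Phi_inf b1 b2 g1 g2 (theta + eps) x) N /\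
         St = mul22 N (Phi_inf b1 b2 g1 g2 (theta - eps) x)).

(* Main.v *)
(* Write b = b2 - b1, g = g2 - g1, p = r u with u = e^{i theta}.  The entry omega_theta
   is a Laplace transform along a ray, so it may be differentiated under the integral
   sign; since - p / (1 - p/g) = g - g / (1 - p/g), this gives
   omega' = g (int v(p) e^{-xp} dp - omega), and termwise integration of v gives
   int v(p) e^{-xp} dp = (1 - e^{-b/x}) / b.  These two facts are exactly the equation
   L1 Phi12 = Phi2.

   For the Stokes matrix, v is replaced by its partial sums, the tails being
   O(e^{|b| r} / n) uniformly on the rays.  From p^{k+1} / (1 - p/g) =
   g (p^k / (1 - p/g) - p^k) and the fact that int p^k e^{-xp} dp = k! / x^{k+1} does not
   depend on the ray, the jump of the k-th moment is g^k times that of the zeroth one,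
   so the jump of omega is v(g) times the jump of int e^{-xp} / (1 - p/g) dp.  The latter
   is computed on a triangle with vertices 0, l e^{i (theta - eps)}, l e^{i (theta + eps)}:
   the integral of e^{t x (g-p)} / (g-p) over its boundary is independent of t, is
   elementary at t = 0, and at t = 1 its third side is negligible as l grows. *)

Require Import Defs.
From Stdlib Require Import Reals ZArith Lra Lia.
From Coquelicot Require Import Coquelicot.
Open Scope C_scope.

(** * Complex-valued functions of a real or complex variable *)

(** Only polynomials times the kernel are compared on two rays, so [v] itself is never moved across
    the pole; all that is asked of it is a tail estimate. One factorial in its coefficients pays for
    e^{|b| r}, the other for 1 / n, and the rate |b| is what the condition Re (x u) > |b| beats.

    The residue enters through a homotopy: with q = g - p, the t-derivative of e^{t x q} / q is x
    e^{t x q}, which has a primitive, so its integral over a closed triangle vanishes. This is used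
    in discrete form: increments in t are quadratic, hence the integral is constant. At t = 0 all
    three sides contribute, and their logarithms and arctangents tend to - 2 pi i in total; only at
    t = 1 does the exponential kill the third side. The sign is that of 1 / (g - p) on a positively
    oriented triangle, whence S = - v(g). *)

Notation is_RIntC := (is_RInt (V := C_R_NormedModule)).
Notation is_Cderive := (is_derive (K := C_AbsRing) (V := C_NormedModule)).
Notation is_Rderive := (is_derive (K := R_AbsRing) (V := C_R_NormedModule)).

Lemma norm_C_R (z : C) : norm (V := C_R_NormedModule) z = Cmod z.
Proof.
unfold norm; simpl; unfold prod_norm, Cmod; f_equal.
unfold norm; simpl; unfold abs; simpl.
now rewrite 2!Rmult_1_r, <- 2!Rabs_mult, 2!Rabs_right; [ring| |]; apply Rle_ge, Rle_0_sqr.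
Qed.

Lemma Cmod_minus_sym (y z : C) : Cmod (y - z) = Cmod (z - y).
Proof. rewrite <- Cmod_opp; f_equal; ring. Qed.

Lemma Cmod_eq_0_lt (z : C) : (forall eps : R, (0 < eps)%R -> (Cmod z <= eps)%R) -> z = 0.
Proof.
intros H; apply Cmod_eq_0.
destruct (Rle_lt_or_eq_dec _ _ (Cmod_ge_0 z)) as [Hz|]; [|easy].
specialize (H (Cmod z / 2)%R ltac:(lra)); lra.
Qed.

(** [K] is independent of [n] and may have any sign: comparisons with partial sums and the
    subdivision of [0, 1] all conclude in this form. *)
Lemma Cmod_eq_0_inv_nat (z : C) (K : R) :
  (forall n : nat, (Cmod z <= K / INR (S n))%R) -> z = 0.
Proof.
intros H; apply Cmod_eq_0_lt; intros eps He.
destruct (nfloor_ex (Rabs K / eps)%R) as [n Hn].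
{ apply Rdiv_le_0_compat; [apply Rabs_pos|easy]. }
apply Rle_trans with (1 := H n).
pose proof (lt_0_INR (S n) ltac:(lia)) as Hp.
apply Rle_div_l; [easy|].
rewrite S_INR in *.
apply Rle_trans with (1 := Rle_abs K).
destruct Hn as [_ Hn]. apply Rlt_div_l in Hn; [lra|easy].
Qed.

(** * Derivatives in epsilon-delta form *)

Lemma is_Cderive_intro (f : C -> C) (x l : C) :
  (forall eps : R, (0 < eps)%R -> exists d : R, (0 < d)%R /\
     forall h : C, (Cmod h < d)%R -> (Cmod (f (x + h) - f x - h * l)%C <= eps * Cmod h)%R) ->
  is_Cderive f x l.
Proof.
intros H; split.
{ apply is_linear_scal_l. }
intros y Hy.
(* The derivative is tested at every limit point of [locally x]; separation leaves only [x]. *)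
apply (is_filter_lim_locally_unique (K := C_AbsRing) (V := AbsRing_NormedModule C_AbsRing)) in Hy.
subst y.
intros [eps He].
destruct (H eps He) as [d [Hd HH]].
exists (mkposreal d Hd); intros y Hy.
change (Cmod (y - x) < d)%R in Hy.
specialize (HH _ Hy).
assert (E : forall a b : C, a + (b - a) = b) by (intros; ring).
rewrite E in HH.
exact HH.
Qed.

Lemma is_Cderive_elim (f : C -> C) (x l : C) :
  is_Cderive f x l ->
  forall eps : R, (0 < eps)%R -> exists d : R, (0 < d)%R /\
     forall h : C, (Cmod h < d)%R -> (Cmod (f (x + h) - f x - h * l)%C <= eps * Cmod h)%R.
Proof.
intros [_ H] eps He.
destruct (H x (fun P HP => HP) (mkposreal eps He)) as [[d Hd] HH].
exists d; split; [easy|]; intros h Hh.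
specialize (HH (x + h)).
assert (E : x + h - x = h) by ring.
rewrite <- E at 2 3.
apply HH.
change (Cmod (x + h - x) < d)%R; now rewrite E.
Qed.

Lemma is_Rderive_intro (f : R -> C) (x : R) (l : C) :
  (forall eps : R, (0 < eps)%R -> exists d : R, (0 < d)%R /\
     forall h : R, (Rabs h < d)%R ->
       (Cmod (f (x + h)%R - f x - RtoC h * l)%C <= eps * Rabs h)%R) ->
  is_Rderive f x l.
Proof.
intros H; split.
{ apply is_linear_scal_l. }
intros y Hy.
apply (is_filter_lim_locally_unique (K := R_AbsRing) (V := AbsRing_NormedModule R_AbsRing)) in Hy.
subst y.
intros [eps He].
destruct (H eps He) as [d [Hd HH]].
exists (mkposreal d Hd); intros y Hy.
change (Rabs (y - x) < d)%R in Hy.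
specialize (HH _ Hy).
assert (E : forall a b : R, (a + (b - a))%R = b) by (intros; ring).
rewrite E in HH.
rewrite norm_C_R.
eapply Rle_trans; [|exact HH].
right; f_equal.
unfold minus, plus, opp, scal; simpl; unfold prod_scal, prod_plus, prod_opp; simpl.
unfold scal, mult, plus, opp; simpl; unfold mult; simpl.
apply injective_projections; simpl; ring.
Qed.

(** Turns complex primitives into real-variable ones, on segments and on rays alike. *)
Lemma is_Rderive_comp_line (F : C -> C) (a u l : C) (t : R) :
  is_Cderive F (a + RtoC t * u) l ->
  is_Rderive (fun s => F (a + RtoC s * u)) t (u * l).
Proof.
intros H; apply is_Rderive_intro; intros eps He.
set (K := (Cmod u + 1)%R).
assert (HK : (0 < K)%R) by (pose proof (Cmod_ge_0 u); unfold K; lra).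
destruct (is_Cderive_elim _ _ _ H (eps / K)%R) as [d [Hd HH]].
{ now apply Rdiv_lt_0_compat. }
exists (d / K)%R; split; [now apply Rdiv_lt_0_compat|].
intros h Hh.
assert (HhK : (Rabs h * K < d)%R) by now apply Rlt_div_r in Hh.
assert (Hm : Cmod (RtoC h * u) = (Rabs h * Cmod u)%R) by now rewrite Cmod_mult, Cmod_R.
pose proof (Rabs_pos h) as Hh0.
assert (Hle : (Rabs h * Cmod u <= Rabs h * K)%R)
  by (apply Rmult_le_compat_l; [easy|unfold K; lra]).
specialize (HH (RtoC h * u)).
rewrite Hm in HH.
replace (a + RtoC (t + h) * u) with (a + RtoC t * u + RtoC h * u) by (rewrite RtoC_plus; ring).
replace (RtoC h * (u * l)) with (RtoC h * u * l) by ring.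
apply Rle_trans with (1 := HH ltac:(lra)).
apply Rle_trans with (eps / K * (Rabs h * K))%R.
{ apply Rmult_le_compat_l; [|easy]. apply Rlt_le, Rdiv_lt_0_compat; lra. }
right; field; lra.
Qed.

Lemma is_Rderive_pair (f g : R -> R) (x l m : R) :
  is_derive f x l -> is_derive g x m -> is_Rderive (fun t => (f t, g t)) x (l, m).
Proof.
intros Hf Hg.
assert (Q : forall (f : R -> R) l, is_derive f x l -> forall eps : R, (0 < eps)%R ->
  exists d : R, (0 < d)%R /\ forall h : R, (Rabs h < d)%R ->
   (Rabs (f (x + h) - f x - h * l) <= eps * Rabs h)%R).
{ clear; intros f l [_ H] eps He.
  destruct (H x (fun P HP => HP) (mkposreal eps He)) as [[d Hd] HH].
  exists d; split; [easy|]; intros h Hh.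
  specialize (HH (x + h)%R).
  assert (E : (x + h - x = h)%R) by ring.
  rewrite <- E at 2 3.
  apply HH.
  change (Rabs (x + h - x) < d)%R; now rewrite E. }
apply is_Rderive_intro; intros eps He.
destruct (Q f l Hf (eps / 2)%R ltac:(lra)) as [d1 [Hd1 H1]].
destruct (Q g m Hg (eps / 2)%R ltac:(lra)) as [d2 [Hd2 H2]].
exists (Rmin d1 d2); split; [now apply Rmin_pos|].
intros h Hh.
specialize (H1 h (Rlt_le_trans _ _ _ Hh (Rmin_l _ _))).
specialize (H2 h (Rlt_le_trans _ _ _ Hh (Rmin_r _ _))).
set (A := (f (x + h) - f x - h * l)%R) in *.
set (B := (g (x + h) - g x - h * m)%R) in *.
replace (_ - _ - _) with (RtoC A + Ci * RtoC B)
  by (apply injective_projections; simpl; unfold A, B; ring).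
apply Rle_trans with (1 := Cmod_triangle _ _).
rewrite Cmod_mult, Cmod_Ci, 2!Cmod_R; lra.
Qed.

(** * Continuity of complex functions of a real variable *)

Lemma continuous_RC_intro (f : R -> C) (x : R) :
  (forall eps : R, (0 < eps)%R -> exists d : R, (0 < d)%R /\
     forall y : R, (Rabs (y - x) < d)%R -> (Cmod (f y - f x)%C < eps)%R) ->
  continuous (U := C_UniformSpace) f x.
Proof.
intros H; apply filterlim_locally; intros [eps He].
destruct (H eps He) as [d [Hd HH]].
exists (mkposreal d Hd); intros y Hy.
apply C_NormedModule_mixin_compat1.
now apply HH.
Qed.

Lemma continuous_RC_elim (f : R -> C) (x : R) :
  continuous (U := C_UniformSpace) f x ->
  forall eps : R, (0 < eps)%R -> exists d : R, (0 < d)%R /\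
     forall y : R, (Rabs (y - x) < d)%R -> (Cmod (f y - f x)%C < eps)%R.
Proof.
intros H eps He.
(* Balls of the uniform structure on [C] are squares, and the square of half-side e around a point
   lies in the disc of radius sqrt 2 * e. *)
assert (He2 : (0 < eps / sqrt 2)%R) by (apply Rdiv_lt_0_compat; [easy|apply sqrt_lt_R0; lra]).
destruct (proj1 (filterlim_locally f (f x)) H (mkposreal _ He2)) as [[d Hd] HH].
exists d; split; [easy|]; intros y Hy.
specialize (HH y Hy).
apply C_NormedModule_mixin_compat2 in HH; simpl in HH.
replace (sqrt 2 * (eps / sqrt 2))%R with eps in HH; [exact HH|].
field; apply Rgt_not_eq, sqrt_lt_R0; lra.
Qed.

Lemma continuous_RC_mult (f g : R -> C) (x : R) :
  continuous (U := C_UniformSpace) f x -> continuous (U := C_UniformSpace) g x ->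
  continuous (U := C_UniformSpace) (fun r => f r * g r) x.
Proof.
intros Hf Hg; apply continuous_RC_intro; intros eps He.
set (A := (Cmod (f x) + Cmod (g x) + 1)%R).
assert (HA : (1 <= A)%R) by (pose proof (Cmod_ge_0 (f x)); pose proof (Cmod_ge_0 (g x)); unfold A; lra).
set (e := Rmin 1 (eps / (2 * A))).
assert (Hep : (0 < eps / (2 * A))%R) by (apply Rdiv_lt_0_compat; lra).
assert (He' : (0 < e)%R) by (apply Rmin_pos; lra).
destruct (continuous_RC_elim _ _ Hf e He') as [d1 [Hd1 H1]].
destruct (continuous_RC_elim _ _ Hg e He') as [d2 [Hd2 H2]].
exists (Rmin d1 d2); split; [now apply Rmin_pos|].
intros y Hy.
specialize (H1 y (Rlt_le_trans _ _ _ Hy (Rmin_l _ _))).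
specialize (H2 y (Rlt_le_trans _ _ _ Hy (Rmin_r _ _))).
replace (f y * g y - f x * g x) with
  ((f y - f x) * (g y - g x) + ((f y - f x) * g x + f x * (g y - g x))) by ring.
apply Rle_lt_trans with (1 := Cmod_triangle _ _).
apply Rle_lt_trans with (1 := Rplus_le_compat_l _ _ _ (Cmod_triangle _ _)).
rewrite 3!Cmod_mult.
pose proof (Cmod_ge_0 (f y - f x)). pose proof (Cmod_ge_0 (g y - g x)).
pose proof (Cmod_ge_0 (f x)). pose proof (Cmod_ge_0 (g x)).
assert (e <= 1)%R by apply Rmin_l.
assert (He2 : (e * (2 * A) <= eps)%R).
{ apply Rle_trans with (eps / (2 * A) * (2 * A))%R; [|right; field; lra].
  apply Rmult_le_compat_r; [lra|apply Rmin_r]. }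
assert (Cmod (f y - f x)%C * Cmod (g y - g x)%C <= e * 1)%R
  by (apply Rmult_le_compat; lra).
assert (Cmod (f y - f x)%C * Cmod (g x) <= e * Cmod (g x))%R
  by (apply Rmult_le_compat_r; lra).
assert (Cmod (f x) * Cmod (g y - g x)%C <= Cmod (f x) * e)%R
  by (apply Rmult_le_compat_l; lra).
unfold A in He2; nra.
Qed.

Lemma continuous_RC_inv (f : R -> C) (x : R) :
  continuous (U := C_UniformSpace) f x -> f x <> 0 ->
  continuous (U := C_UniformSpace) (fun r => / f r) x.
Proof.
intros Hf H0; apply continuous_RC_intro; intros eps He.
set (m := Cmod (f x)).
assert (Hm : (0 < m)%R) by now apply Cmod_gt_0.
assert (He' : (0 < eps * (m * m / 2))%R) by (apply Rmult_lt_0_compat; nra).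
destruct (continuous_RC_elim _ _ Hf (Rmin (m / 2) (eps * (m * m / 2)))) as [d [Hd H]].
{ apply Rmin_pos; lra. }
exists d; split; [easy|]; intros y Hy; specialize (H y Hy).
assert (H1 := Rlt_le_trans _ _ _ H (Rmin_l _ _)).
assert (H2 := Rlt_le_trans _ _ _ H (Rmin_r _ _)).
assert (Hy2 : (m / 2 < Cmod (f y))%R).
{ pose proof (Cmod_triangle (f y) (- (f y - f x))) as T.
  replace (f y + - (f y - f x)) with (f x) in T by ring.
  rewrite Cmod_opp in T; fold m in T; lra. }
assert (Hy0 : f y <> 0) by (apply Cmod_gt_0; lra).
replace (/ f y - / f x) with (- (f y - f x) / (f y * f x)) by (field; easy).
rewrite Cmod_div by now apply Cmult_neq_0.
rewrite Cmod_opp, Cmod_mult; fold m.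
apply Rlt_div_l; [nra|].
apply Rlt_le_trans with (1 := H2).
apply Rmult_le_compat_l; [lra|nra].
Qed.

Lemma is_Cderive_continuous_line (F : C -> C) (a u l : C) (t : R) :
  is_Cderive F (a + RtoC t * u) l ->
  continuous (U := C_UniformSpace) (fun s : R => F (a + RtoC s * u)) t.
Proof.
intros H; apply (ex_derive_continuous (K := R_AbsRing) (V := C_R_NormedModule)).
exists (u * l); now apply is_Rderive_comp_line.
Qed.

(** In [C_R_NormedModule] only real numbers act as scalars, so a complex factor is handled through
    real and imaginary parts. *)
Lemma is_RIntC_scal (f : R -> C) (a b : R) (c l : C) :
  is_RIntC f a b l -> is_RIntC (fun r => c * f r) a b (c * l).
Proof.
intros H.
pose proof (is_RInt_fct_extend_fst (U := R_NormedModule) (V := R_NormedModule) _ _ _ _ H) as H1.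
pose proof (is_RInt_fct_extend_snd (U := R_NormedModule) (V := R_NormedModule) _ _ _ _ H) as H2.
apply (is_RInt_fct_extend_pair (U := R_NormedModule) (V := R_NormedModule)); simpl.
- apply (is_RInt_minus (V := R_NormedModule) (fun t => fst c * fst (f t))%R);
  now apply (is_RInt_scal (V := R_NormedModule)).
- apply (is_RInt_plus (V := R_NormedModule) (fun t => fst c * snd (f t))%R);
  now apply (is_RInt_scal (V := R_NormedModule)).
Qed.

Lemma is_RIntC_ext (f g : R -> C) (a b : R) (l : C) :
  (a <= b)%R -> (forall r : R, (a <= r <= b)%R -> f r = g r) ->
  is_RIntC f a b l -> is_RIntC g a b l.
Proof.
intros Hab H; apply is_RInt_ext.
rewrite Rmin_left, Rmax_right by easy.
intros r Hr; apply H; lra.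
Qed.

Lemma ex_RIntC_continuous (f : R -> C) (a b : R) :
  (a <= b)%R ->
  (forall r : R, (a <= r <= b)%R -> continuous (U := C_UniformSpace) f r) ->
  exists l : C, is_RIntC f a b l.
Proof.
intros Hab H.
apply (ex_RInt_continuous (V := C_R_CompleteNormedModule)).
now rewrite Rmin_left, Rmax_right.
Qed.

Lemma is_RIntC_derive (f df : R -> C) (a b : R) :
  (a <= b)%R ->
  (forall r : R, (a <= r <= b)%R -> is_Rderive f r (df r)) ->
  (forall r : R, (a <= r <= b)%R -> continuous (U := C_UniformSpace) df r) ->
  is_RIntC df a b (f b - f a).
Proof.
intros Hab H1 H2.
apply (is_RInt_derive (V := C_R_CompleteNormedModule));
now rewrite Rmin_left, Rmax_right.
Qed.

Lemma Cmod_RInt_le (f : R -> C) (g : R -> R) (a b : R) (lf : C) (lg : R) :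
  (a <= b)%R -> (forall r : R, (a <= r <= b)%R -> (Cmod (f r) <= g r)%R) ->
  is_RIntC f a b lf -> is_RInt g a b lg -> (Cmod lf <= lg)%R.
Proof.
intros Hab H Hf Hg; rewrite <- norm_C_R.
apply (norm_RInt_le f g a b lf lg Hab); try easy.
intros r Hr; rewrite norm_C_R; now apply H.
Qed.

Lemma Cmod_RInt_le_const (f : R -> C) (a b M : R) (lf : C) :
  (a <= b)%R -> (forall r : R, (a <= r <= b)%R -> (Cmod (f r) <= M)%R) ->
  is_RIntC f a b lf -> (Cmod lf <= (b - a) * M)%R.
Proof.
intros Hab H Hf; rewrite <- norm_C_R.
apply (norm_RInt_le_const f a b lf M Hab); try easy.
intros r Hr; rewrite norm_C_R; now apply H.
Qed.

(** * The complex exponential *)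

Lemma Cexp_add (a b : C) : Cexp (a + b) = Cexp a * Cexp b.
Proof.
unfold Cexp; destruct a as [a1 a2], b as [b1 b2]; simpl.
rewrite exp_plus, cos_plus, sin_plus.
apply injective_projections; simpl; ring.
Qed.

Lemma Cexp_0 : Cexp 0 = 1.
Proof.
unfold Cexp; simpl; rewrite exp_0, cos_0, sin_0.
apply injective_projections; simpl; ring.
Qed.

Lemma Cexp_opp_r (a : C) : Cexp a * Cexp (- a) = 1.
Proof. rewrite <- Cexp_add, <- Cexp_0; f_equal; ring. Qed.

Lemma Cexp_neq_0 (a : C) : Cexp a <> 0.
Proof.
intros H; pose proof (Cexp_opp_r a) as E; rewrite H, Cmult_0_l in E.
apply RtoC_inj in E; lra.
Qed.

Lemma Cmod_Cexp (z : C) : Cmod (Cexp z) = exp (Re z).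
Proof.
unfold Cexp; rewrite Cmod_mult, Cmod_R, Rabs_right by (apply Rle_ge, Rlt_le, exp_pos).
unfold Cmod; simpl.
replace (_ + _)%R with 1%R by (generalize (sin2_cos2 (Im z)); unfold Rsqr; lra).
rewrite sqrt_1; ring.
Qed.

Lemma Re_le_Cmod (z : C) : (Re z <= Cmod z)%R.
Proof. apply Rle_trans with (2 := re_le_Cmod z), Rle_abs. Qed.

Lemma Re_opp (z : C) : Re (- z) = (- Re z)%R.
Proof. easy. Qed.

Lemma Re_plus (y z : C) : Re (y + z) = (Re y + Re z)%R.
Proof. easy. Qed.

Lemma Re_scal (t : R) (z : C) : Re (RtoC t * z) = (t * Re z)%R.
Proof. unfold Re; simpl; ring. Qed.

Lemma Im_scal (t : R) (z : C) : Im (RtoC t * z) = (t * Im z)%R.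
Proof. unfold Im; simpl; ring. Qed.

Lemma Cmod_Cexp_le (z : C) : (Cmod (Cexp z) <= exp (Cmod z))%R.
Proof.
rewrite Cmod_Cexp; destruct (Rle_lt_or_eq_dec _ _ (Re_le_Cmod z)) as [H|H].
- now apply Rlt_le, exp_increasing.
- rewrite H; apply Rle_refl.
Qed.

Lemma exp_le (x y : R) : (x <= y)%R -> (exp x <= exp y)%R.
Proof.
intros [H|H]; [now apply Rlt_le, exp_increasing|rewrite H; apply Rle_refl].
Qed.

Lemma Cexpi_eq (t : R) : Cexpi t = (cos t, sin t).
Proof.
unfold Cexpi, Cexp.
replace (Re (Ci * RtoC t)) with 0%R by (unfold Re; simpl; ring).
replace (Im (Ci * RtoC t)) with t by (unfold Im; simpl; ring).
rewrite exp_0; ring.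
Qed.

Lemma Cmod_Cexpi (t : R) : Cmod (Cexpi t) = 1%R.
Proof.
unfold Cexpi; rewrite Cmod_Cexp.
replace (Re (Ci * RtoC t)) with 0%R by (unfold Re; simpl; ring).
apply exp_0.
Qed.

Lemma Cexpi_neq_0 (t : R) : Cexpi t <> 0.
Proof. apply Cexp_neq_0. Qed.

Lemma Cexpi_add (s t : R) : Cexpi (s + t) = Cexpi s * Cexpi t.
Proof. unfold Cexpi; rewrite <- Cexp_add; f_equal; rewrite RtoC_plus; ring. Qed.

Lemma is_Rderive_Cexp_line (z : C) (t : R) :
  is_Rderive (fun s => Cexp (RtoC s * z)) t (z * Cexp (RtoC t * z)).
Proof.
apply (is_derive_ext (K := R_AbsRing) (V := C_R_NormedModule)
  (fun s : R => (exp (s * Re z) * cos (s * Im z), exp (s * Re z) * sin (s * Im z))%R)).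
{ intros s; unfold Cexp; rewrite Re_scal, Im_scal.
  apply injective_projections; simpl; ring. }
replace (z * Cexp (RtoC t * z)) with
  ((Re z * exp (t * Re z) * cos (t * Im z) - exp (t * Re z) * (Im z * sin (t * Im z)))%R,
   (Re z * exp (t * Re z) * sin (t * Im z) + exp (t * Re z) * (Im z * cos (t * Im z)))%R).
- apply is_Rderive_pair; auto_derive; trivial; ring.
- unfold Cexp; rewrite Re_scal, Im_scal.
  apply injective_projections; unfold Re, Im; simpl; ring.
Qed.

Lemma is_Rderive_RtoC_mult (f : R -> R) (c : C) (t l : R) :
  is_derive f t l -> is_Rderive (fun s => RtoC (f s) * c) t (RtoC l * c).
Proof.
intros H.
apply (is_derive_ext (K := R_AbsRing) (V := C_R_NormedModule)
  (fun s : R => (f s * fst c, f s * snd c)%R)).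
{ intros s; apply injective_projections; simpl; ring. }
replace (RtoC l * c) with ((l * fst c)%R, (l * snd c)%R)
  by (apply injective_projections; simpl; ring).
apply is_Rderive_pair;
exact (is_derive_scal_l f t l _ H).
Qed.

(** The exponential series without its terms of degree below [n]; differentiation lowers the
    index. *)
Fixpoint exp_rem (n : nat) (z : C) : C :=
  match n with
  | O => Cexp z
  | S m => exp_rem m z - z ^ m / RtoC (INR (fact m))
  end.

Lemma INR_fact_C_neq_0 (n : nat) : RtoC (INR (fact n)) <> 0.
Proof. intros H; apply RtoC_inj in H; now apply INR_fact_neq_0 in H. Qed.

Lemma exp_rem_S_0 (n : nat) : exp_rem (S n) 0 = 0.
Proof.
induction n as [|n IH].
- simpl; rewrite Cexp_0; field; apply (INR_fact_C_neq_0 0).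
- change (exp_rem (S n) 0 - 0 ^ S n / RtoC (INR (fact (S n))) = 0).
  rewrite IH, Cpow_S; field; apply INR_fact_C_neq_0.
Qed.

Lemma is_Rderive_exp_rem_line (n : nat) (z : C) (t : R) :
  is_Rderive (fun s => exp_rem n (RtoC s * z)) t (z * exp_rem (pred n) (RtoC t * z)).
Proof.
induction n as [|n IH].
{ apply is_Rderive_Cexp_line. }
apply (is_derive_ext (K := R_AbsRing) (V := C_R_NormedModule)
  (fun s : R => minus (G := C_R_NormedModule) (exp_rem n (RtoC s * z))
     (RtoC (s ^ n) * (z ^ n / RtoC (INR (fact n)))))).
{ intros s; change (exp_rem n (RtoC s * z) - RtoC (s ^ n) * (z ^ n / RtoC (INR (fact n))) =
  exp_rem n (RtoC s * z) - (RtoC s * z) ^ n / RtoC (INR (fact n))).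
  rewrite Cpow_mult_l, RtoC_pow; field; apply INR_fact_C_neq_0. }
evar_last.
{ apply (is_derive_minus (K := R_AbsRing) (V := C_R_NormedModule)).
  - exact IH.
  - apply is_Rderive_RtoC_mult.
    apply (is_derive_pow (fun s => s) n t 1%R), (is_derive_id (K := R_AbsRing)). }
match goal with |- minus ?a ?b = _ => change (a - b = z * exp_rem n (RtoC t * z)) end.
destruct n as [|n].
- simpl; rewrite Rmult_0_l, Rmult_0_l; ring.
- change (exp_rem (S n) (RtoC t * z)) with
    (exp_rem n (RtoC t * z) - (RtoC t * z) ^ n / RtoC (INR (fact n))).
  simpl pred.
  rewrite Cpow_mult_l, Rmult_1_r, RtoC_mult, RtoC_pow, fact_simpl, mult_INR, RtoC_mult, Cpow_S.
  field; split; [apply INR_fact_C_neq_0|].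
  intros H; apply RtoC_inj in H; now apply not_0_INR in H.
Qed.

(** Induction on [n]: [exp_rem (S n)] vanishes at 0, hence is the integral over 0 <= t <= 1 of z
    times [exp_rem n] at t z, and the factor t^n in the bound for the latter integrates to 1 / (n +
    1). *)
Lemma Cmod_exp_rem_le (n : nat) (z : C) :
  (Cmod (exp_rem n z) <= Cmod z ^ n / INR (fact n) * exp (Cmod z))%R.
Proof.
revert z; induction n as [|n IH]; intros z.
{ simpl; rewrite Rdiv_1_r, Rmult_1_l; apply Cmod_Cexp_le. }
assert (Hz := Cmod_ge_0 z).
assert (H : is_RIntC (fun t => z * exp_rem n (RtoC t * z)) 0 1 (exp_rem (S n) z)).
{ replace (exp_rem (S n) z) with (exp_rem (S n) (RtoC 1 * z) - exp_rem (S n) (RtoC 0 * z))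
    by (rewrite Cmult_0_l, exp_rem_S_0, Cmult_1_l; ring).
  apply (is_RIntC_derive (fun t => exp_rem (S n) (RtoC t * z))); [lra| |].
  - intros r _; apply (is_Rderive_exp_rem_line (S n)).
  - intros r _; apply continuous_RC_mult.
    + apply (continuous_const (V := C_UniformSpace)).
    + apply (ex_derive_continuous (K := R_AbsRing) (V := C_R_NormedModule)).
      eexists; apply is_Rderive_exp_rem_line. }
refine (Cmod_RInt_le _ (fun t => (Cmod z ^ S n / INR (fact n) * exp (Cmod z)) * t ^ n)%R
  0 1 _ _ ltac:(lra) _ H _).
- intros t Ht; rewrite Cmod_mult.
  assert (Hm : Cmod (RtoC t * z) = (t * Cmod z)%R)
    by (rewrite Cmod_mult, Cmod_R, Rabs_right; lra).
  specialize (IH (RtoC t * z)); rewrite Hm, Rpow_mult_distr in IH.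
  replace (_ * t ^ n)%R with (Cmod z * (t ^ n * Cmod z ^ n / INR (fact n) * exp (Cmod z)))%R
    by (simpl; field; apply INR_fact_neq_0).
  apply Rmult_le_compat_l; [easy|].
  apply Rle_trans with (1 := IH).
  apply Rmult_le_compat_l.
  + apply Rdiv_le_0_compat; [|apply INR_fact_lt_0].
    apply Rmult_le_pos; apply pow_le; lra.
  + apply exp_le; nra.
- evar_last.
  + apply (is_RInt_scal (V := R_NormedModule) (fun t => t ^ n)%R).
    apply (is_RInt_derive (V := R_CompleteNormedModule)
      (fun t => t ^ S n / INR (S n))%R (fun t => t ^ n)%R).
    * intros t _; auto_derive; [trivial|].
      replace (match n with O => 1%R | S _ => (INR n + 1)%R end) with (INR (S n)) by easy.
      field; now apply not_0_INR.
    * intros t _; apply (ex_derive_continuous (fun t => t ^ n)%R); now auto_derive.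
  + rewrite fact_simpl, mult_INR.
    unfold scal, minus, plus, opp; simpl; unfold mult; simpl.
    replace (match n with O => 1%R | S _ => (INR n + 1)%R end) with (INR (S n)) by easy.
    rewrite pow1; field; split; [apply INR_fact_neq_0|now apply not_0_INR].
Qed.

(** Square of 1 + y / 2 <= e^{y/2}. It absorbs the factor r^2 that appears when a Laplace transform
    is differentiated. *)
Lemma exp_ge_quadratic (y : R) : (0 <= y)%R -> (y * y / 4 <= exp y)%R.
Proof.
intros Hy.
pose proof (exp_ineq1_le (y / 2)) as H.
replace y with (y / 2 + y / 2)%R at 3 by field.
rewrite exp_plus; nra.
Qed.

Lemma Cmod_exp_rem_2_le (z : C) : (Cmod (Cexp z - 1 - z)%C <= Cmod z * Cmod z * exp (Cmod z))%R.
Proof.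
pose proof (Cmod_exp_rem_le 2 z) as H.
replace (exp_rem 2 z) with (Cexp z - 1 - z) in H
  by (simpl; field; intros H0; apply RtoC_inj in H0; lra).
apply Rle_trans with (1 := H).
apply Rmult_le_compat_r; [apply Rlt_le, exp_pos|].
simpl; pose proof (Cmod_ge_0 z); nra.
Qed.

Lemma is_Cderive_Cexp (x : C) : is_Cderive Cexp x (Cexp x).
Proof.
apply is_Cderive_intro; intros eps He.
set (K := (Cmod (Cexp x) * exp 1)%R).
assert (HK : (0 < K)%R).
{ apply Rmult_lt_0_compat; [apply Cmod_gt_0, Cexp_neq_0|apply exp_pos]. }
exists (Rmin 1 (eps / K)); split.
{ apply Rmin_pos; [lra|now apply Rdiv_lt_0_compat]. }
intros h Hh.
assert (H1 := Rlt_le_trans _ _ _ Hh (Rmin_l _ _)).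
assert (H2 := Rlt_le_trans _ _ _ Hh (Rmin_r _ _)).
apply Rlt_div_r in H2; [|easy].
replace (Cexp (x + h) - Cexp x - h * Cexp x) with (Cexp x * (Cexp h - 1 - h))
  by (rewrite Cexp_add; ring).
rewrite Cmod_mult.
pose proof (Cmod_exp_rem_2_le h) as H.
pose proof (Cmod_ge_0 h) as Hh0; pose proof (Cmod_ge_0 (Cexp x)).
assert (He1 : (exp (Cmod h) <= exp 1)%R) by (apply exp_le; lra).
apply Rle_trans with (Cmod (Cexp x) * (Cmod h * Cmod h * exp 1))%R.
{ apply Rmult_le_compat_l; [easy|]. apply Rle_trans with (1 := H).
  apply Rmult_le_compat_l; nra. }
unfold K in H2; nra.
Qed.

(** The product and chain rules concern [C] as a module over its own absolute ring. Both structures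
    have the same norm, so only the linearity half of the derivative is rebuilt. *)
Lemma is_Cderive_AbsRing (f : C -> C) (x l : C) :
  is_Cderive f x l <-> is_derive (K := C_AbsRing) (V := AbsRing_NormedModule C_AbsRing) f x l.
Proof.
split; intros [_ H]; (split; [apply is_linear_scal_l|exact H]).
Qed.

Lemma is_Cderive_mult (f g : C -> C) (x df dg : C) :
  is_Cderive f x df -> is_Cderive g x dg ->
  is_Cderive (fun y => f y * g y) x (df * g x + f x * dg).
Proof.
intros Hf Hg; apply is_Cderive_AbsRing.
apply (is_derive_mult (K := C_AbsRing) f g x df dg); [..|exact Cmult_comm];
now apply is_Cderive_AbsRing.
Qed.

Lemma is_Cderive_comp (f g : C -> C) (x df dg : C) :
  is_Cderive f (g x) df -> is_Cderive g x dg ->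
  is_Cderive (fun y => f (g y)) x (dg * df).
Proof.
intros Hf Hg.
apply (is_derive_comp (K := C_AbsRing) (V := C_NormedModule) f g x df dg Hf).
now apply is_Cderive_AbsRing.
Qed.

Lemma is_Cderive_id (x : C) : is_Cderive (fun y => y) x (RtoC 1).
Proof. apply is_Cderive_AbsRing, (is_derive_id (K := C_AbsRing)). Qed.

Lemma is_Cderive_const (c x : C) : is_Cderive (fun _ => c) x (RtoC 0).
Proof. apply (is_derive_const (K := C_AbsRing) (V := C_NormedModule)). Qed.

Lemma is_Cderive_plus (f g : C -> C) (x df dg : C) :
  is_Cderive f x df -> is_Cderive g x dg ->
  is_Cderive (fun y => f y + g y) x (df + dg).
Proof. apply (is_derive_plus (K := C_AbsRing) (V := C_NormedModule)). Qed.

Lemma is_Cderive_eq (f : C -> C) (x l l' : C) :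
  is_Cderive f x l -> l = l' -> is_Cderive f x l'.
Proof. now intros H <-. Qed.

Lemma is_Cderive_ext (f g : C -> C) (x l : C) :
  (forall y, f y = g y) -> is_Cderive f x l -> is_Cderive g x l.
Proof. apply (is_derive_ext (K := C_AbsRing) (V := C_NormedModule)). Qed.

Lemma is_Cderive_scal (c : C) (f : C -> C) (x df : C) :
  is_Cderive f x df -> is_Cderive (fun y => c * f y) x (c * df).
Proof.
intros H; apply (is_Cderive_eq _ _ _ _ (is_Cderive_mult _ _ _ _ _ (is_Cderive_const c x) H)).
ring.
Qed.

Lemma is_Cderive_pow (n : nat) (x : C) :
  is_Cderive (fun y => y ^ S n) x (RtoC (INR (S n)) * x ^ n).
Proof.
induction n as [|n IH].
- apply (is_Cderive_ext (fun y => y)); [intros y; ring|].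
  apply (is_Cderive_eq _ _ _ _ (is_Cderive_id x)); simpl; ring.
- apply (is_Cderive_ext (fun y => y * y ^ S n)); [intros y; now rewrite (Cpow_S y (S n))|].
  apply (is_Cderive_eq _ _ _ _ (is_Cderive_mult _ _ _ _ _ (is_Cderive_id x) IH)).
  rewrite (S_INR (S n)), RtoC_plus, (Cpow_S x n); ring.
Qed.

Lemma is_Cderive_inv (x : C) : x <> 0 -> is_Cderive (fun y => / y) x (- (1) / x ^ 2).
Proof.
intros Hx; apply is_Cderive_intro; intros eps He.
set (m := Cmod x).
assert (Hm : (0 < m)%R) by now apply Cmod_gt_0.
(* The first bound keeps |x + h| above |x| / 2; the second then controls the exact remainder h^2 /
   ((x + h) x^2). *)
exists (Rmin (m / 2) (eps * (m * m * m / 2))); split.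
{ apply Rmin_pos; [lra|]. apply Rmult_lt_0_compat; [easy|].
  apply Rdiv_lt_0_compat; [|lra]. now repeat apply Rmult_lt_0_compat. }
intros h Hh.
assert (H1 := Rlt_le_trans _ _ _ Hh (Rmin_l _ _)).
assert (H2 := Rlt_le_trans _ _ _ Hh (Rmin_r _ _)).
assert (Hy : (m / 2 < Cmod (x + h))%R).
{ pose proof (Cmod_triangle (x + h) (- h)) as T.
  replace (x + h + - h) with x in T by ring.
  rewrite Cmod_opp in T; fold m in T; lra. }
assert (Hy0 : x + h <> 0) by (apply Cmod_gt_0; lra).
replace (/ (x + h) - / x - h * (- (1) / x ^ 2)) with (h * h / ((x + h) * (x * x)))
  by (field; easy).
rewrite Cmod_div by (repeat apply Cmult_neq_0; easy).
rewrite 3!Cmod_mult; fold m.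
pose proof (Cmod_ge_0 h) as Hh0.
assert (Hmm : (0 < m * m)%R) by now apply Rmult_lt_0_compat.
apply Rle_div_l; [nra|].
rewrite Rmult_assoc, (Rmult_comm (Cmod h) (_ * _)), <- Rmult_assoc.
apply Rmult_le_compat_r; [easy|].
apply Rle_trans with (eps * (m / 2 * (m * m)))%R; [lra|].
apply Rmult_le_compat_l; [lra|nra].
Qed.

(** * Integrals and Laplace transforms along a ray *)

Notation is_RInt_ray f l :=
  (is_RInt_gen (V := C_R_NormedModule) f (at_point 0%R) (Rbar_locally p_infty) l).

Lemma is_RInt_ray_intro (f : R -> C) (l : C) :
  (forall eps : R, (0 < eps)%R -> exists R0 : R, forall r : R, (R0 < r)%R ->
     exists y : C, is_RIntC f 0 r y /\ (Cmod (y - l)%C < eps)%R) ->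
  is_RInt_ray f l.
Proof.
intros H P [[eps He] HP].
destruct (H eps He) as [R0 HR].
apply (Filter_prod _ _ _ (fun a => a = 0%R) (fun r => R0 < r)%R); [easy|now exists R0|].
intros a r -> Hr; simpl.
destruct (HR r Hr) as [y [H1 H2]].
exists y; split; [exact H1|].
now apply HP, C_NormedModule_mixin_compat1.
Qed.

Lemma is_RInt_ray_elim (f : R -> C) (l : C) :
  is_RInt_ray f l ->
  forall eps : R, (0 < eps)%R -> exists R0 : R, forall r : R, (R0 < r)%R ->
     exists y : C, is_RIntC f 0 r y /\ (Cmod (y - l)%C < eps)%R.
Proof.
intros H eps He.
assert (He2 : (0 < eps / sqrt 2)%R) by (apply Rdiv_lt_0_compat; [easy|apply sqrt_lt_R0; lra]).
destruct (H _ (locally_ball l (mkposreal _ He2))) as [Q T HQ [R0 HT] HH].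
exists R0; intros r Hr.
destruct (HH 0%R r HQ (HT r Hr)) as [y [H1 H2]].
exists y; split; [exact H1|].
apply C_NormedModule_mixin_compat2 in H2; simpl in H2.
replace (sqrt 2 * (eps / sqrt 2))%R with eps in H2; [exact H2|].
field; apply Rgt_not_eq, sqrt_lt_R0; lra.
Qed.

Lemma is_RInt_ray_unique (f : R -> C) (l l' : C) :
  is_RInt_ray f l -> is_RInt_ray f l' -> l = l'.
Proof.
intros H H'.
rewrite <- (is_RInt_gen_unique (V := C_R_CompleteNormedModule) f l H).
now apply (is_RInt_gen_unique (V := C_R_CompleteNormedModule)).
Qed.

Lemma is_RInt_ray_scal (f : R -> C) (c l : C) :
  is_RInt_ray f l -> is_RInt_ray (fun r => c * f r) (c * l).
Proof.
intros H; apply is_RInt_ray_intro; intros eps He.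
assert (Hc := Cmod_ge_0 c).
destruct (is_RInt_ray_elim _ _ H (eps / (Cmod c + 1))) as [R0 HR].
{ apply Rdiv_lt_0_compat; lra. }
exists R0; intros r Hr; destruct (HR r Hr) as [y [H1 H2]].
exists (c * y); split; [now apply is_RIntC_scal|].
replace (c * y - c * l) with (c * (y - l)) by ring.
rewrite Cmod_mult.
apply Rlt_div_r in H2; [|lra].
pose proof (Cmod_ge_0 (y - l)); nra.
Qed.

Lemma is_RInt_ray_plus (f g : R -> C) (lf lg : C) :
  is_RInt_ray f lf -> is_RInt_ray g lg -> is_RInt_ray (fun r => f r + g r) (lf + lg).
Proof. apply (is_RInt_gen_plus (V := C_R_NormedModule)). Qed.

Lemma is_RInt_ray_minus (f g : R -> C) (lf lg : C) :
  is_RInt_ray f lf -> is_RInt_ray g lg -> is_RInt_ray (fun r => f r - g r) (lf - lg).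
Proof. apply (is_RInt_gen_minus (V := C_R_NormedModule)). Qed.

Lemma is_RInt_ray_ext (f g : R -> C) (l : C) :
  (forall r : R, (0 <= r)%R -> f r = g r) -> is_RInt_ray f l -> is_RInt_ray g l.
Proof.
intros H; apply (is_RInt_gen_ext (V := C_R_NormedModule)).
apply (Filter_prod _ _ _ (fun a => a = 0%R) (fun r => 0 < r)%R); [easy|now exists 0%R|].
intros a r -> Hr x; simpl; rewrite Rmin_left by lra.
intros Hx; apply H; lra.
Qed.

Lemma is_RInt_exp_decay (M d a b : R) : d <> 0%R ->
  is_RInt (fun r => M * exp (- (d * r)))%R a b
    (M / d * (exp (- (d * a)) - exp (- (d * b))))%R.
Proof.
intros Hd; evar_last.
- apply (is_RInt_derive (V := R_CompleteNormedModule) (fun r => - (M / d) * exp (- (d * r)))%R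
    (fun r => M * exp (- (d * r)))%R).
  + intros r _; auto_derive; trivial; now field.
  + intros r _; apply (ex_derive_continuous (fun r => M * exp (- (d * r)))%R); now auto_derive.
- unfold minus, plus, opp; simpl; ring.
Qed.

Lemma exp_decay_lt (K d eps : R) : (0 < d)%R -> (0 < eps)%R ->
  exists R0 : R, (0 <= R0)%R /\ forall r : R, (R0 < r)%R -> (K * exp (- (d * r)) < eps)%R.
Proof.
intros Hd He; exists (Rabs K / eps / d)%R; split.
{ repeat apply Rdiv_le_0_compat; try lra; apply Rabs_pos. }
intros r Hr.
apply (proj1 (Rlt_div_l _ _ _ Hd)), (proj1 (Rlt_div_l _ _ _ He)) in Hr.
rewrite exp_Ropp.
apply (Rlt_div_l K eps (exp (d * r))); [apply exp_pos|].
pose proof (Rmult_le_compat_l eps _ _ (Rlt_le _ _ He) (exp_ineq1_le (d * r))).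
pose proof (Rle_abs K); lra.
Qed.

(** The bound does not involve [b]: it is the tail estimate for the Cauchy criterion and, at
    [a = 0], the bound for the whole ray. *)
Lemma Cmod_RInt_exp_decay_le (f : R -> C) (M d a b : R) (l : C) :
  (0 < d)%R -> (0 <= a <= b)%R ->
  (forall r : R, (0 <= r)%R -> (Cmod (f r) <= M * exp (- (d * r)))%R) ->
  is_RIntC f a b l -> (Cmod l <= M / d * exp (- (d * a)))%R.
Proof.
intros Hd Hab Hf Hl.
assert (H := Cmod_RInt_le f _ a b l _ (proj2 Hab)
  (fun r Hr => Hf r (Rle_trans _ _ _ (proj1 Hab) (proj1 Hr))) Hl
  (is_RInt_exp_decay M d a b (Rgt_not_eq _ _ Hd))).
apply Rle_trans with (1 := H).
assert (HM : (0 <= M)%R).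
{ pose proof (Hf 0%R (Rle_refl 0)) as H0; rewrite Rmult_0_r, Ropp_0, exp_0 in H0.
  pose proof (Cmod_ge_0 (f 0%R)); lra. }
apply Rmult_le_compat_l; [apply Rdiv_le_0_compat; lra|].
pose proof (exp_pos (- (d * b))); lra.
Qed.

(** Domination by a decaying exponential makes the integrals over [0, b] a Cauchy family as b
    grows. *)
Lemma ex_RInt_ray (f : R -> C) (M d : R) :
  (0 < d)%R ->
  (forall r : R, (0 <= r)%R -> continuous (U := C_UniformSpace) f r) ->
  (forall r : R, (0 <= r)%R -> (Cmod (f r) <= M * exp (- (d * r)))%R) ->
  exists l : C, is_RInt_ray f l.
Proof.
intros Hd Hc Hf.
assert (Hex : forall a b, (0 <= a <= b)%R ->
  is_RIntC f a b (RInt (V := C_R_CompleteNormedModule) f a b)).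
{ intros a b Hab; apply (RInt_correct (V := C_R_CompleteNormedModule)).
  apply ex_RIntC_continuous; [easy|]; intros r Hr; apply Hc; lra. }
set (F := fun b => RInt (V := C_R_CompleteNormedModule) f 0 b : C).
assert (HF : forall a b, (0 <= a <= b)%R -> (Cmod (F b - F a) <= M / d * exp (- (d * a)))%R).
{ intros a b Hab.
  apply (Cmod_RInt_exp_decay_le f M d a b); try easy.
  replace (F b - F a) with (RInt (V := C_R_CompleteNormedModule) f a b); [now apply Hex|].
  unfold F; rewrite <- (RInt_Chasles (V := C_R_CompleteNormedModule) f 0 a b).
  - assert (E : forall y z : C, z = y + z - y) by (intros; ring); apply E.
  - exists (F a); apply Hex; lra.
  - eexists; now apply Hex. }
assert (HL : exists l : C, filterlim F (Rbar_locally p_infty) (locally (T := C_UniformSpace) l)).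
{ apply (filterlim_locally_cauchy (U := C_R_CompleteNormedModule)).
  intros [eps He].
  destruct (exp_decay_lt (M / d) d eps Hd He) as [R0 [HR0 HR]].
  exists (fun r => R0 < r)%R; split; [now exists R0|].
  intros a b Ha Hb; apply C_NormedModule_mixin_compat1; simpl.
  destruct (Rle_dec a b) as [Hab|Hab].
  - apply Rle_lt_trans with (2 := HR a Ha).
    apply HF; lra.
  - change (Cmod (F b - F a) < eps)%R; rewrite Cmod_minus_sym.
    apply Rle_lt_trans with (2 := HR b Hb).
    apply HF; lra. }
destruct HL as [l HL]; exists l.
apply is_RInt_ray_intro; intros eps He.
assert (He2 : (0 < eps / sqrt 2)%R) by (apply Rdiv_lt_0_compat; [easy|apply sqrt_lt_R0; lra]).
destruct (proj1 (filterlim_locally F l) HL (mkposreal _ He2)) as [R0 HR].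
exists (Rmax 0 R0); intros r Hr.
exists (F r); split.
{ apply Hex; split; [lra|]. apply Rlt_le, Rle_lt_trans with (2 := Hr), Rmax_l. }
specialize (HR r (Rle_lt_trans _ _ _ (Rmax_r _ _) Hr)).
apply C_NormedModule_mixin_compat2 in HR; simpl in HR.
replace (sqrt 2 * (eps / sqrt 2))%R with eps in HR; [exact HR|].
field; apply Rgt_not_eq, sqrt_lt_R0; lra.
Qed.

Lemma Cmod_RInt_ray_le (f : R -> C) (M d : R) (l : C) :
  (0 < d)%R ->
  (forall r : R, (0 <= r)%R -> (Cmod (f r) <= M * exp (- (d * r)))%R) ->
  is_RInt_ray f l -> (Cmod l <= M / d)%R.
Proof.
intros Hd Hf Hl; apply le_epsilon; intros eps He.
destruct (is_RInt_ray_elim _ _ Hl eps He) as [R0 HR].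
destruct (HR (Rmax 0 R0 + 1)%R) as [y [H1 H2]].
{ pose proof (Rmax_r 0 R0); lra. }
assert (H3 := Cmod_RInt_exp_decay_le f M d _ _ y Hd
  (conj (Rle_refl 0) (Rplus_le_le_0_compat _ _ (Rmax_l 0 R0) Rle_0_1)) Hf H1).
rewrite Rmult_0_r, Ropp_0, exp_0, Rmult_1_r in H3.
replace l with (y + - (y - l)) by ring.
apply Rle_trans with (1 := Cmod_triangle _ _).
rewrite Cmod_opp; lra.
Qed.

(** * Laplace transforms of functions of exponential growth *)

Section LaplaceTransform.

Variables (phi : R -> C) (M a : R) (u : C).
Hypothesis phi_continuous :
  forall r : R, (0 <= r)%R -> continuous (U := C_UniformSpace) phi r.
Hypothesis phi_le : forall r : R, (0 <= r)%R -> (Cmod (phi r) <= M * exp (a * r))%R.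
Hypothesis u_unit : Cmod u = 1%R.

Lemma Cmod_laplace_kernel (x : C) (r : R) :
  Cmod (Cexp (- (x * (RtoC r * u)))) = exp (- (Re (x * u) * r)).
Proof.
rewrite Cmod_Cexp; f_equal.
replace (- (x * (RtoC r * u))) with (RtoC (- r) * (x * u)) by (rewrite RtoC_opp; ring).
rewrite Re_scal; ring.
Qed.

Lemma continuous_ray (r : R) :
  continuous (U := C_UniformSpace) (fun r : R => RtoC r * u) r.
Proof.
apply (continuous_ext (T := R_UniformSpace) (U := C_UniformSpace) (fun r : R => 0 + RtoC r * u)).
{ intros s; apply Cplus_0_l. }
eapply (is_Cderive_continuous_line (fun p => p)), is_Cderive_id.
Qed.

Lemma continuous_laplace_kernel (x : C) (r : R) :
  continuous (U := C_UniformSpace) (fun r : R => Cexp (- (x * (RtoC r * u)))) r.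
Proof.
apply (continuous_ext (T := R_UniformSpace) (U := C_UniformSpace)
  (fun r : R => Cexp (0 + RtoC r * (- (x * u))))).
{ intros s; f_equal; ring. }
eapply (is_Cderive_continuous_line Cexp), is_Cderive_Cexp.
Qed.

Lemma phi_bound_ge_0 : (0 <= M)%R.
Proof.
pose proof (phi_le 0%R (Rle_refl 0)) as H; rewrite Rmult_0_r, exp_0 in H.
pose proof (Cmod_ge_0 (phi 0%R)); lra.
Qed.

Lemma Cmod_laplace_le (x : C) (r : R) : (0 <= r)%R ->
  (Cmod (phi r * Cexp (- (x * (RtoC r * u))))%C <= M * exp (- ((Re (x * u) - a) * r)))%R.
Proof.
intros Hr; rewrite Cmod_mult, Cmod_laplace_kernel.
replace (- ((Re (x * u) - a) * r))%R with (a * r + - (Re (x * u) * r))%R by ring.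
rewrite exp_plus, <- Rmult_assoc.
apply Rmult_le_compat_r; [apply Rlt_le, exp_pos|now apply phi_le].
Qed.

Lemma ex_laplace (x : C) : (a < Re (x * u))%R ->
  exists l : C, is_RInt_ray (fun r : R => phi r * Cexp (- (x * (RtoC r * u)))) l.
Proof.
intros Hx; apply (ex_RInt_ray _ M (Re (x * u) - a)); [lra| |].
- intros r Hr; apply continuous_RC_mult; [now apply phi_continuous|apply continuous_laplace_kernel].
- apply Cmod_laplace_le.
Qed.

(** Subtracting the linear term under the integral leaves the integrand times e^w - 1 - w with w = -
    h p, hence O(|h|^2). [D] is any value of the differentiated integral, so that its closed form
    can be found separately. *)
Lemma is_Cderive_laplace (L : C -> C) (x D : C) :
  (forall y : C, (a < Re (y * u))%R ->
     is_RInt_ray (fun r : R => phi r * Cexp (- (y * (RtoC r * u)))) (L y)) ->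
  (a < Re (x * u))%R ->
  is_RInt_ray (fun r : R => - (RtoC r * u) * (phi r * Cexp (- (x * (RtoC r * u))))) D ->
  is_Cderive L x D.
Proof.
intros HL Hx HD.
(* The margin is split in three: e^{- 3 d r} pays for e^{|h| r}, for the factor r^2, and for
   convergence. *)
set (d := ((Re (x * u) - a) / 3)%R).
assert (Hd : (0 < d)%R) by (unfold d; lra).
assert (HM := phi_bound_ge_0).
assert (Key : forall h : C, (Cmod h < d)%R ->
  (Cmod (L (x + h) - L x - h * D)%C <= Cmod h * Cmod h * (M * 4 / (d * d)) / d)%R).
{ intros h Hh.
  assert (Hxh : (a < Re ((x + h) * u))%R).
  { replace ((x + h) * u) with (x * u + h * u) by ring; rewrite Re_plus.
    pose proof (re_le_Cmod (h * u)) as T; rewrite Cmod_mult, u_unit, Rmult_1_r in T.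
    pose proof (Rle_abs (- Re (h * u))) as T2; rewrite Rabs_Ropp in T2.
    unfold d in Hh; lra. }
  assert (HI := is_RInt_ray_minus _ _ _ _
    (is_RInt_ray_minus _ _ _ _ (HL _ Hxh) (HL _ Hx)) (is_RInt_ray_scal _ h _ HD)).
  refine (Cmod_RInt_ray_le _ _ d _ Hd _ HI).
  intros r Hr.
  match goal with |- (Cmod ?e <= _)%R =>
    replace e with (phi r * Cexp (- (x * (RtoC r * u))) *
      (Cexp (- (h * (RtoC r * u))) - 1 - (- (h * (RtoC r * u))))) end.
  2: { replace (- ((x + h) * (RtoC r * u))) with (- (x * (RtoC r * u)) + - (h * (RtoC r * u))) by ring.
       rewrite Cexp_add; ring. }
  rewrite Cmod_mult.
  assert (Hm : Cmod (- (h * (RtoC r * u))) = (Cmod h * r)%R).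
  { rewrite Cmod_opp, 2!Cmod_mult, u_unit, Cmod_R, Rabs_right; lra. }
  assert (E := Cmod_exp_rem_2_le (- (h * (RtoC r * u)))); rewrite Hm in E.
  assert (Hh0 := Cmod_ge_0 h).
  apply Rle_trans with
    ((M * exp (- ((Re (x * u) - a) * r))) * (Cmod h * r * (Cmod h * r) * exp (d * r)))%R.
  { apply Rmult_le_compat; [apply Cmod_ge_0..|now apply Cmod_laplace_le|].
    apply Rle_trans with (1 := E).
    apply Rmult_le_compat_l; [nra|apply exp_le; nra]. }
  replace (- ((Re (x * u) - a) * r))%R with (- (d * r) + (- (d * r) + - (d * r)))%R
    by (unfold d; field).
  rewrite 2!exp_plus.
  assert (Hdr : (d * r * (d * r) / 4 <= exp (d * r))%R)
    by (apply exp_ge_quadratic, Rmult_le_pos; lra).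
  assert (Hr2 : (r * r <= 4 / (d * d) * exp (d * r))%R).
  { replace (r * r)%R with (4 / (d * d) * (d * r * (d * r) / 4))%R by (field; lra).
    apply Rmult_le_compat_l; [|easy]. apply Rdiv_le_0_compat; nra. }
  assert (Ee : (exp (- (d * r)) * exp (d * r) = 1)%R)
    by (rewrite <- exp_plus, <- exp_0; f_equal; ring).
  replace (_ * (_ * (_ * _)) * _)%R with
    (M * (Cmod h * Cmod h) * exp (- (d * r)) *
      ((exp (- (d * r)) * exp (d * r)) * (r * r) * exp (- (d * r))))%R by ring.
  rewrite Ee, Rmult_1_l.
  replace (Cmod h * Cmod h * (M * 4 / (d * d)) * exp (- (d * r)))%R with
    (M * (Cmod h * Cmod h) * exp (- (d * r)) * (4 / (d * d) * (exp (- (d * r)) * exp (d * r))))%R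
    by (rewrite Ee; field; lra).
  apply Rmult_le_compat_l.
  { apply Rmult_le_pos; [|apply Rlt_le, exp_pos]. apply Rmult_le_pos; nra. }
  rewrite (Rmult_comm (exp (- _)) (exp (d * r))), <- Rmult_assoc.
  apply Rmult_le_compat_r; [apply Rlt_le, exp_pos|easy]. }
set (K := (M * 4 / (d * d) / d)%R) in *.
assert (HK : (0 <= K)%R).
{ unfold K; apply Rdiv_le_0_compat; [|easy]. apply Rdiv_le_0_compat; nra. }
apply is_Cderive_intro; intros eps He.
exists (Rmin d (eps / (K + 1))); split.
{ apply Rmin_pos; [easy|]. apply Rdiv_lt_0_compat; lra. }
intros h Hh.
assert (H1 := Rlt_le_trans _ _ _ Hh (Rmin_l _ _)).
assert (H2 := Rlt_le_trans _ _ _ Hh (Rmin_r _ _)).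
apply Rlt_div_r in H2; [|lra].
apply Rle_trans with (1 := Key h H1).
assert (Hh0 := Cmod_ge_0 h).
replace (Cmod h * Cmod h * (M * 4 / (d * d)) / d)%R with (Cmod h * K * Cmod h)%R
  by (unfold K; field; lra).
apply Rmult_le_compat_r; [easy|]. nra.
Qed.

End LaplaceTransform.

(** * The Borel transform v *)

Definition Csum (a : nat -> C) (n : nat) : C := sum_n (G := C_NormedModule) a n.

Lemma Csum_S (a : nat -> C) (n : nat) : Csum a (S n) = Csum a n + a (S n).
Proof. exact (sum_Sn (G := C_NormedModule) a n). Qed.

Lemma Csum_0 (a : nat -> C) : Csum a 0 = a 0%nat.
Proof. exact (sum_O (G := C_NormedModule) a). Qed.

Lemma Rsum_S (a : nat -> R) (n : nat) : sum_n a (S n) = (sum_n a n + a (S n))%R.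
Proof. exact (sum_Sn a n). Qed.

Lemma pow_div_fact_ge_0 (y : R) (n : nat) : (0 <= y)%R -> (0 <= y ^ n / INR (fact n))%R.
Proof. intros Hy; apply Rdiv_le_0_compat; [now apply pow_le|apply INR_fact_lt_0]. Qed.

Lemma sum_exp_ge_0 (y : R) (n : nat) : (0 <= y)%R ->
  (0 <= sum_n (fun k => y ^ k / INR (fact k)) n)%R.
Proof.
intros Hy; induction n as [|n IH]; [rewrite sum_O; now apply pow_div_fact_ge_0|].
rewrite Rsum_S; apply Rplus_le_le_0_compat; [easy|now apply pow_div_fact_ge_0].
Qed.

Lemma sum_exp_le (y : R) (n : nat) : (0 <= y)%R ->
  (sum_n (fun k => y ^ k / INR (fact k)) n <= exp y)%R.
Proof.
intros Hy.
assert (H := is_exp_Reals y).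
assert (H' : is_lim_seq (sum_n (fun k => y ^ k / INR (fact k))%R) (exp y)).
{ apply (is_series_ext _ (fun k => y ^ k / INR (fact k))%R) in H; [exact H|].
  intros k; rewrite pow_n_pow; easy. }
revert n; apply (is_lim_seq_incr_compare _ _ H'); intros n.
rewrite Rsum_S; pose proof (pow_div_fact_ge_0 y (S n) Hy); lra.
Qed.

Lemma pow_div_fact_le_exp (y : R) (n : nat) : (0 <= y)%R -> (y ^ n / INR (fact n) <= exp y)%R.
Proof.
intros Hy; apply Rle_trans with (2 := sum_exp_le y n Hy).
destruct n as [|n]; [rewrite sum_O; apply Rle_refl|].
rewrite Rsum_S; pose proof (sum_exp_ge_0 y n Hy); lra.
Qed.

(** e^{d r} dominates its term of degree n + 1, so r^n e^{- d r} is at most K / r. *)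
Lemma pow_exp_decay_lt (n : nat) (d eps : R) : (0 < d)%R -> (0 < eps)%R ->
  exists R0 : R, forall r : R, (R0 < r)%R -> (r ^ n * exp (- (d * r)) < eps)%R.
Proof.
intros Hd He.
set (K := (INR (fact (S n)) / d ^ S n)%R).
assert (HK : (0 < K)%R) by (apply Rdiv_lt_0_compat; [apply INR_fact_lt_0|now apply pow_lt]).
exists (K / eps)%R; intros r Hr.
assert (Hr0 : (0 < r)%R) by (apply Rlt_trans with (2 := Hr); now apply Rdiv_lt_0_compat).
apply (proj1 (Rlt_div_l _ _ _ He)) in Hr.
assert (H := pow_div_fact_le_exp (d * r) (S n) ltac:(nra)).
rewrite exp_Ropp.
apply (Rlt_div_l (r ^ n) eps (exp (d * r))); [apply exp_pos|].
apply Rlt_le_trans with (eps * ((d * r) ^ S n / INR (fact (S n))))%R.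
2: { apply Rmult_le_compat_l; lra. }
replace ((d * r) ^ S n / INR (fact (S n)))%R with (r * r ^ n / K)%R.
2: { unfold K; rewrite Rpow_mult_distr; change (r ^ S n)%R with (r * r ^ n)%R; field.
     split; [apply INR_fact_neq_0|apply pow_nonzero; lra]. }
assert (Hrn : (0 < r ^ n)%R) by now apply pow_lt.
replace (eps * (r * r ^ n / K))%R with (r ^ n * (r * eps / K))%R by (field; lra).
rewrite <- (Rmult_1_r (r ^ n)) at 1.
apply Rmult_lt_compat_l; [easy|].
apply Rlt_div_r; lra.
Qed.

(** Taylor coefficients in p of J_1(2 sqrt(b p)) / sqrt(b p), where J_1 is the Bessel function. *)
Definition v_coeff (b : C) (k : nat) : C :=
  (- (1)) ^ k * b ^ k / RtoC (INR (fact k) * INR (fact (S k))).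

Lemma Cmod_v_term_le (b p : C) (k : nat) :
  (Cmod (v_coeff b k * p ^ k)%C <=
     (Cmod b * Cmod p) ^ k / INR (fact k) / INR (fact (S k)))%R.
Proof.
assert (H1 := INR_fact_lt_0 k). assert (H2 := INR_fact_lt_0 (S k)).
unfold v_coeff; rewrite Cmod_mult, Cmod_div, Cmod_mult, 3!Cmod_pow, Cmod_m1, pow1, Cmod_R.
2: { intros H; apply RtoC_inj in H; apply Rmult_integral in H; lra. }
rewrite Rabs_right, Rpow_mult_distr by (apply Rle_ge, Rlt_le; nra).
right; field; lra.
Qed.

Lemma INR_S_le_fact (n : nat) : (INR (S n) <= INR (fact (S n)))%R.
Proof.
apply le_INR; rewrite fact_simpl.
pose proof (lt_O_fact n); nia.
Qed.

(** For k > n the factor 1 / (k + 1)! is at most 1 / (n + 1), and the other factorial leaves a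
    partial sum of the series of e^{|b| |p|}. Only this exponential, of rate |b|, reaches the
    integrals. *)
Lemma Cmod_v_tail_le (b p : C) (n m : nat) :
  (Cmod (Csum (fun k => v_coeff b k * p ^ k) (n + m) - Csum (fun k => v_coeff b k * p ^ k) n)%C
   <= exp (Cmod b * Cmod p) / INR (S n))%R.
Proof.
set (y := (Cmod b * Cmod p)%R).
assert (Hy : (0 <= y)%R) by (apply Rmult_le_pos; apply Cmod_ge_0).
assert (Hn : (0 < INR (S n))%R) by (apply lt_0_INR; lia).
(* The partial sum replaces the exponential so that the induction on [m] can add one term on each
   side. *)
apply Rle_trans with (sum_n (fun k => y ^ k / INR (fact k))%R (n + m) / INR (S n))%R.
2: { apply Rmult_le_compat_r; [apply Rlt_le, Rinv_0_lt_compat; lra|now apply sum_exp_le]. }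
induction m as [|m IH].
- rewrite Nat.add_0_r.
  unfold Cminus; rewrite Cplus_opp_r.
  rewrite Cmod_0; apply Rdiv_le_0_compat; [now apply sum_exp_ge_0|easy].
- rewrite Nat.add_succ_r, Csum_S, Rsum_S.
  match goal with |- (Cmod (?A + ?B - ?D)%C <= _)%R =>
    replace (A + B - D) with ((A - D) + B) by ring end.
  apply Rle_trans with (1 := Cmod_triangle _ _).
  rewrite Rdiv_plus_distr.
  apply Rplus_le_compat; [exact IH|].
  apply Rle_trans with (1 := Cmod_v_term_le b p (S (n + m))); fold y.
  apply Rmult_le_compat_l.
  { apply Rdiv_le_0_compat; [now apply pow_le|apply INR_fact_lt_0]. }
  apply Rinv_le_contravar; [easy|].
  apply Rle_trans with (2 := INR_S_le_fact _).
  apply le_INR; lia.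
Qed.

(** [v] is a definite description, so both existence and uniqueness of the sum are required;
    existence is by comparison with the series of e^y. *)
Lemma is_series_v (b1 b2 p : C) :
  is_series (V := C_NormedModule) (fun k => v_coeff (b2 - b1) k * p ^ k) (v b1 b2 p).
Proof.
assert (Hex : ex_series (V := C_CompleteNormedModule) (fun k => v_coeff (b2 - b1) k * p ^ k)).
{ set (y := (Cmod (b2 - b1) * Cmod p)%R).
  assert (Hy : (0 <= y)%R) by (apply Rmult_le_pos; apply Cmod_ge_0).
  apply (ex_series_le (V := C_CompleteNormedModule) _ (fun k => y ^ k / INR (fact k))%R).
  - intros k; change (Cmod (v_coeff (b2 - b1) k * p ^ k)%C <= y ^ k / INR (fact k))%R.
    apply Rle_trans with (1 := Cmod_v_term_le _ p k); fold y.
    rewrite <- (Rdiv_1_r (y ^ k / INR (fact k))) at 2.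
    apply Rmult_le_compat_l.
    { apply Rdiv_le_0_compat; [now apply pow_le|apply INR_fact_lt_0]. }
    apply Rinv_le_contravar; [lra|].
    apply Rle_trans with (2 := INR_S_le_fact _).
    apply (le_INR 1); lia.
  - exists (exp y); generalize (is_exp_Reals y); apply is_series_ext.
    intros k; rewrite pow_n_pow; easy. }
destruct Hex as [l Hl].
assert (E : v b1 b2 p = l); [|now rewrite E].
apply (iota_unique (V := C_CompleteNormedModule)); [|exact Hl].
intros y Hy; exact (filterlim_locally_unique (V := C_NormedModule) _ _ _ Hy Hl).
Qed.

Lemma Cmod_v_minus_sum_le (b1 b2 p : C) (n : nat) :
  (Cmod (v b1 b2 p - Csum (fun k => v_coeff (b2 - b1) k * p ^ k) n)%C
    <= exp (Cmod (b2 - b1) * Cmod p) / INR (S n))%R.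
Proof.
apply le_epsilon; intros eps He.
set (S_ := Csum (fun k => v_coeff (b2 - b1) k * p ^ k)).
assert (He2 : (0 < eps / sqrt 2)%R) by (apply Rdiv_lt_0_compat; [easy|apply sqrt_lt_R0; lra]).
destruct (proj1 (filterlim_locally _ _) (is_series_v b1 b2 p) (mkposreal _ He2)) as [N HN].
(* The index [n + N] is beyond the threshold [N] and has the form required by the tail estimate. *)
specialize (HN (n + N)%nat ltac:(lia)).
apply C_NormedModule_mixin_compat2 in HN; simpl in HN.
replace (sqrt 2 * (eps / sqrt 2))%R with eps in HN.
2: { field; apply Rgt_not_eq, sqrt_lt_R0; lra. }
change (Cmod (S_ (n + N)%nat - v b1 b2 p)%C < eps)%R in HN.
replace (v b1 b2 p - S_ n) with ((S_ (n + N)%nat - S_ n) + - (S_ (n + N)%nat - v b1 b2 p))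
  by ring.
apply Rle_trans with (1 := Cmod_triangle _ _).
rewrite Cmod_opp.
apply Rplus_le_compat; [apply Cmod_v_tail_le|lra].
Qed.

(** The tail estimate at n = 0, with the leading term 1 absorbed in the exponential. *)
Lemma Cmod_v_le (b1 b2 p : C) : (Cmod (v b1 b2 p) <= 2 * exp (Cmod (b2 - b1) * Cmod p))%R.
Proof.
assert (H := Cmod_v_minus_sum_le b1 b2 p 0).
rewrite Csum_0 in H; unfold v_coeff in H; simpl in H.
set (e := exp _) in *.
assert (He : (1 <= e)%R).
{ unfold e; rewrite <- exp_0; apply exp_le, Rmult_le_pos; apply Cmod_ge_0. }
replace (v b1 b2 p) with ((v b1 b2 p - 1 * 1 / (RtoC (1 * 1)) * 1) + 1)
  by (rewrite Rmult_1_r; field; intros H0; apply RtoC_inj in H0; lra).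
apply Rle_trans with (1 := Cmod_triangle _ _).
rewrite Cmod_1; lra.
Qed.

Lemma continuous_ray_pow (u : C) (k : nat) (r : R) :
  continuous (U := C_UniformSpace) (fun r : R => (RtoC r * u) ^ k) r.
Proof.
induction k as [|k IH].
- apply (continuous_const (V := C_UniformSpace)).
- apply continuous_RC_mult; [apply continuous_ray|exact IH].
Qed.

(** Locally uniform limit of polynomials: the tail estimate is uniform on |s - r| < 1. *)
Lemma continuous_v_ray (b1 b2 u : C) (r : R) :
  continuous (U := C_UniformSpace) (fun r : R => v b1 b2 (RtoC r * u)) r.
Proof.
set (Sn := fun n s => Csum (fun k => v_coeff (b2 - b1) k * (RtoC s * u) ^ k) n : C).
assert (Hc : forall n, continuous (U := C_UniformSpace) (Sn n) r).
{ intros n; unfold Sn; induction n as [|n IH].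
  - apply (continuous_ext (T := R_UniformSpace) (U := C_UniformSpace)
      (fun s : R => v_coeff (b2 - b1) 0 * (RtoC s * u) ^ 0)); [intros s; now rewrite Csum_0|].
    apply continuous_RC_mult; [apply (continuous_const (V := C_UniformSpace))|].
    apply continuous_ray_pow.
  - apply (continuous_ext (T := R_UniformSpace) (U := C_UniformSpace)
      (fun s : R => Sn n s + v_coeff (b2 - b1) (S n) * (RtoC s * u) ^ (S n)));
      [intros s; now rewrite Csum_S|].
    apply (continuous_plus (K := R_AbsRing) (V := C_R_NormedModule)); [exact IH|].
    apply continuous_RC_mult; [apply (continuous_const (V := C_UniformSpace))|].
    apply continuous_ray_pow. }
set (K := exp (Cmod (b2 - b1) * ((Rabs r + 1) * Cmod u))).
assert (HS : forall n s, (Rabs (s - r) < 1)%R ->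
  (Cmod (v b1 b2 (RtoC s * u) - Sn n s)%C <= K / INR (S n))%R).
{ intros n s Hs; apply Rle_trans with (1 := Cmod_v_minus_sum_le b1 b2 _ n).
  apply Rmult_le_compat_r; [apply Rlt_le, Rinv_0_lt_compat, lt_0_INR; lia|].
  apply exp_le, Rmult_le_compat_l; [apply Cmod_ge_0|].
  rewrite Cmod_mult, Cmod_R; apply Rmult_le_compat_r; [apply Cmod_ge_0|].
  pose proof (Rabs_triang (s - r) r) as T; replace (s - r + r)%R with s in T by ring; lra. }
apply continuous_RC_intro; intros eps He.
assert (HK : (0 < K)%R) by apply exp_pos.
destruct (nfloor_ex (K / (eps / 4))%R) as [n [_ Hn]].
{ apply Rdiv_le_0_compat; lra. }
assert (He4 : (0 < eps / 4)%R) by lra.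
apply (proj1 (Rlt_div_l _ _ _ He4)) in Hn; rewrite <- S_INR in Hn.
assert (HKn : (K / INR (S n) < eps / 4)%R).
{ apply Rlt_div_l; [apply lt_0_INR; lia|lra]. }
destruct (continuous_RC_elim _ _ (Hc n) (eps / 4) ltac:(lra)) as [d [Hd Hd']].
exists (Rmin 1 d); split; [apply Rmin_pos; lra|].
intros s Hs.
assert (H1 := HS n s (Rlt_le_trans _ _ _ Hs (Rmin_l _ _))).
assert (H2 := HS n r ltac:(rewrite Rminus_diag_eq, Rabs_R0 by easy; lra)).
specialize (Hd' s (Rlt_le_trans _ _ _ Hs (Rmin_r _ _))).
replace (v b1 b2 (RtoC s * u) - v b1 b2 (RtoC r * u)) with
 ((v b1 b2 (RtoC s * u) - Sn n s) + ((Sn n s - Sn n r) + - (v b1 b2 (RtoC r * u) - Sn n r))) by ring.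
apply Rle_lt_trans with (1 := Cmod_triangle _ _).
apply Rle_lt_trans with (1 := Rplus_le_compat_l _ _ _ (Cmod_triangle _ _)).
rewrite Cmod_opp; lra.
Qed.

(** The value [- F 0] does not depend on the direction [u]: this is the source of the
    ray-independence of the moments. *)
Lemma is_RInt_ray_derive (F F' : C -> C) (u : C) :
  (forall p : C, is_Cderive F p (F' p)) ->
  (forall r : R, (0 <= r)%R ->
     continuous (U := C_UniformSpace) (fun r : R => F' (RtoC r * u)) r) ->
  (forall eps : R, (0 < eps)%R -> exists R0 : R, forall r : R, (R0 < r)%R ->
     (Cmod (F (RtoC r * u)%C) < eps)%R) ->
  is_RInt_ray (fun r : R => u * F' (RtoC r * u)) (- F 0).
Proof.
intros HF Hc Hlim; apply is_RInt_ray_intro; intros eps He.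
destruct (Hlim eps He) as [R0 HR].
exists (Rmax 0 R0); intros r Hr.
assert (H0 := Rle_lt_trans _ _ _ (Rmax_l _ _) Hr).
exists (F (RtoC r * u) - F (RtoC 0 * u)); split.
- apply (is_RIntC_derive (fun r : R => F (RtoC r * u))); [lra| |].
  + intros s _; generalize (is_Rderive_comp_line F 0 u (F' (RtoC s * u)) s).
    rewrite Cplus_0_l; intros H; specialize (H (HF _)); revert H.
    apply (is_derive_ext (K := R_AbsRing) (V := C_R_NormedModule)).
    intros t; now rewrite Cplus_0_l.
  + intros s Hs; apply continuous_RC_mult; [apply (continuous_const (V := C_UniformSpace))|].
    now apply Hc.
- rewrite Cmult_0_l.
  replace (F (RtoC r * u) - F 0 - - F 0) with (F (RtoC r * u)) by ring.
  apply HR, Rle_lt_trans with (2 := Hr), Rmax_r.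
Qed.

Lemma is_Cderive_exp_lin (x p : C) :
  is_Cderive (fun p => Cexp (- (x * p))) p (- x * Cexp (- (x * p))).
Proof.
apply (is_Cderive_comp Cexp (fun p => - (x * p))); [apply is_Cderive_Cexp|].
apply (is_Cderive_ext (fun p => - x * p)); [intros q; ring|].
apply (is_Cderive_eq _ _ _ _ (is_Cderive_scal (- x) _ _ _ (is_Cderive_id p))); ring.
Qed.

(** Integration by parts: p^{k+1} e^{-xp} vanishes at both ends of the ray, so its derivative
    integrates to 0. *)
Lemma is_RInt_ray_moment (x u : C) (k : nat) : Cmod u = 1%R -> (0 < Re (x * u))%R ->
  is_RInt_ray (fun r : R => (RtoC r * u) ^ k * Cexp (- (x * (RtoC r * u))) * u)
    (RtoC (INR (fact k)) / x ^ S k).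
Proof.
intros Hu Hx.
assert (Hx0 : x <> 0).
{ intros H; rewrite H, Cmult_0_l in Hx; unfold Re in Hx; simpl in Hx; lra. }
induction k as [|k IH].
- apply (is_RInt_ray_ext (fun r : R => - / x * (u * (- x * Cexp (- (x * (RtoC r * u))))))).
  { intros r _; simpl; field; easy. }
  replace (RtoC (INR (fact 0)) / x ^ 1) with (- / x * - Cexp (- (x * 0)))
    by (rewrite Cmult_0_r, Copp_0, Cexp_0; simpl; field; easy).
  apply is_RInt_ray_scal.
  apply (is_RInt_ray_derive (fun p => Cexp (- (x * p))) (fun p => - x * Cexp (- (x * p)))).
  + intros p; apply is_Cderive_exp_lin.
  + intros r _; apply continuous_RC_mult; [apply (continuous_const (V := C_UniformSpace))|].
    apply continuous_laplace_kernel.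
  + intros eps He; destruct (pow_exp_decay_lt 0 _ eps Hx He) as [R0 HR].
    exists R0; intros r Hr; rewrite Cmod_laplace_kernel.
    specialize (HR r Hr); rewrite pow_O, Rmult_1_l in HR; exact HR.
- set (G' := fun p : C => RtoC (INR (S k)) * p ^ k * Cexp (- (x * p)) +
    p ^ S k * (- x * Cexp (- (x * p)))).
  assert (HG : is_RInt_ray (fun r : R => u * G' (RtoC r * u)) (- (0 ^ S k * Cexp (- (x * 0))))).
  { apply (is_RInt_ray_derive (fun p => p ^ S k * Cexp (- (x * p)))).
    - intros p; apply (is_Cderive_mult (fun p => p ^ S k) (fun p => Cexp (- (x * p))));
        [apply is_Cderive_pow|apply is_Cderive_exp_lin].
    - intros r _; apply (continuous_plus (K := R_AbsRing) (V := C_R_NormedModule)).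
      + apply continuous_RC_mult; [apply continuous_RC_mult|apply continuous_laplace_kernel].
        * apply (continuous_const (V := C_UniformSpace)).
        * apply continuous_ray_pow.
      + apply continuous_RC_mult; [apply continuous_ray_pow|].
        apply continuous_RC_mult; [apply (continuous_const (V := C_UniformSpace))|].
        apply continuous_laplace_kernel.
    - intros eps He; destruct (pow_exp_decay_lt (S k) _ eps Hx He) as [R0 HR].
      exists (Rmax 0 R0); intros r Hr.
      assert (H0 := Rle_lt_trans _ _ _ (Rmax_l _ _) Hr).
      rewrite Cmod_mult, Cmod_pow, Cmod_laplace_kernel, Cmod_mult, Cmod_R, Rabs_right, Hu, Rmult_1_r by lra.
      apply HR, Rle_lt_trans with (2 := Hr), Rmax_r. }
  (* The integral of [G'] is (k + 1) M_k - x M_{k+1}, which is solved for the moment M_{k+1}. *)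
  assert (H := is_RInt_ray_scal _ (/ x) _
    (is_RInt_ray_minus _ _ _ _ (is_RInt_ray_scal _ (RtoC (INR (S k))) _ IH) HG)).
  match type of H with is_RInt_ray _ ?l =>
    replace l with (RtoC (INR (fact (S k))) / x ^ S (S k)) in H end.
  2: { rewrite fact_simpl, mult_INR, RtoC_mult, !Cpow_S; field; repeat split; try easy; now apply Cpow_nz. }
  revert H; apply is_RInt_ray_ext; intros r _; unfold G'; rewrite (Cpow_S _ k); field; easy.
Qed.

Lemma is_RInt_ray_sum (f : nat -> R -> C) (l : nat -> C) (n : nat) :
  (forall k : nat, is_RInt_ray (f k) (l k)) ->
  is_RInt_ray (fun r => Csum (fun k => f k r) n : C) (Csum l n).
Proof.
intros H; induction n as [|n IH].
- rewrite Csum_0; apply (is_RInt_ray_ext (f 0%nat)); [|apply H].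
  intros r _; now rewrite Csum_0.
- rewrite Csum_S; apply (is_RInt_ray_ext (fun r => (Csum (fun k => f k r) n : C) + f (S n) r)).
  { intros r _; now rewrite Csum_S. }
  now apply is_RInt_ray_plus.
Qed.

Lemma Csum_ext (a b : nat -> C) (n : nat) : (forall k, a k = b k) -> Csum a n = Csum b n.
Proof. apply (sum_n_ext (G := C_NormedModule)). Qed.

Lemma Csum_mult_r (a : nat -> C) (c : C) (n : nat) :
  Csum (fun k => a k * c) n = Csum a n * c.
Proof. exact (sum_n_mult_r (K := C_Ring) c a n). Qed.

(** The weight [W] covers two uses: u for the Laplace transform of [v], and u / (1 - p / g) for
    [omega]. The tail of [v] costs e^{|b| r}, which leaves the decay rate Re (x u) - |b|. *)
Lemma Cmod_v_integral_minus_sum_le (b1 b2 x u l : C) (W : R -> C) (MW : R) (T : nat -> C) (n : nat) :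
  Cmod u = 1%R -> (Cmod (b2 - b1) < Re (x * u))%R ->
  (forall r : R, (0 <= r)%R -> (Cmod (W r) <= MW)%R) ->
  (forall k : nat,
     is_RInt_ray (fun r : R => (RtoC r * u) ^ k * Cexp (- (x * (RtoC r * u))) * W r) (T k)) ->
  is_RInt_ray (fun r : R => v b1 b2 (RtoC r * u) * Cexp (- (x * (RtoC r * u))) * W r) l ->
  (Cmod (l - Csum (fun k => v_coeff (b2 - b1) k * T k) n)%C
     <= MW / (Re (x * u) - Cmod (b2 - b1)) / INR (S n))%R.
Proof.
intros Hu Hx HW HT Hl.
assert (Hn : (0 < INR (S n))%R) by (apply lt_0_INR; lia).
assert (HS := is_RInt_ray_minus _ _ _ _ Hl
  (is_RInt_ray_sum _ _ n (fun k => is_RInt_ray_scal _ (v_coeff (b2 - b1) k) _ (HT k)))).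
replace (MW / (Re (x * u) - Cmod (b2 - b1)) / INR (S n))%R
  with (MW / INR (S n) / (Re (x * u) - Cmod (b2 - b1)))%R by (field; lra).
refine (Cmod_RInt_ray_le _ _ (Re (x * u) - Cmod (b2 - b1)) _ ltac:(lra) _ HS).
intros r Hr.
match goal with |- (Cmod ?e <= _)%R => replace e with
  ((v b1 b2 (RtoC r * u) - Csum (fun k => v_coeff (b2 - b1) k * (RtoC r * u) ^ k) n) *
    (Cexp (- (x * (RtoC r * u))) * W r)) end.
2: { assert (E : Csum (fun k => v_coeff (b2 - b1) k *
         ((RtoC r * u) ^ k * Cexp (- (x * (RtoC r * u))) * W r)) n =
       Csum (fun k => v_coeff (b2 - b1) k * (RtoC r * u) ^ k) n *
         (Cexp (- (x * (RtoC r * u))) * W r))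
       by (rewrite <- Csum_mult_r; apply Csum_ext; intros k; ring).
     cbv beta; rewrite E; ring. }
rewrite 2!Cmod_mult, Cmod_laplace_kernel.
assert (H1 := Cmod_v_minus_sum_le b1 b2 (RtoC r * u) n).
rewrite (Cmod_mult (RtoC r)), Hu, Cmod_R, Rabs_right, Rmult_1_r in H1 by lra.
apply Rle_trans with (exp (Cmod (b2 - b1) * r) / INR (S n) * (exp (- (Re (x * u) * r)) * MW))%R.
{ apply Rmult_le_compat; [apply Cmod_ge_0| |easy|].
  - apply Rmult_le_pos; [apply Rlt_le, exp_pos|apply Cmod_ge_0].
  - apply Rmult_le_compat_l; [apply Rlt_le, exp_pos|now apply HW]. }
replace (- ((Re (x * u) - Cmod (b2 - b1)) * r))%R with (Cmod (b2 - b1) * r + - (Re (x * u) * r))%R by ring.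
rewrite exp_plus; right; field; lra.
Qed.

Lemma is_RInt_ray_v (b1 b2 x u : C) :
  b1 <> b2 -> Cmod u = 1%R -> (Cmod (b2 - b1) < Re (x * u))%R ->
  is_RInt_ray (fun r : R => v b1 b2 (RtoC r * u) * Cexp (- (x * (RtoC r * u))) * u)
    ((1 - Cexp (- ((b2 - b1) / x))) / (b2 - b1)).
Proof.
intros Hb Hu Hx.
assert (Hb0 : b2 - b1 <> 0).
{ intros H; apply Hb; replace b2 with ((b2 - b1) + b1) by ring; rewrite H; ring. }
assert (Hbp : (0 < Cmod (b2 - b1))%R) by now apply Cmod_gt_0.
assert (Hx0 : x <> 0).
{ intros H; rewrite H, Cmult_0_l in Hx; unfold Re in Hx; simpl in Hx; lra. }
destruct (ex_laplace (fun r : R => u * v b1 b2 (RtoC r * u)) 2 (Cmod (b2 - b1)) u) with (x := x)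
  as [l Hl]; try easy.
{ intros r Hr; apply continuous_RC_mult; [apply (continuous_const (V := C_UniformSpace))|].
  apply continuous_v_ray. }
{ intros r Hr; rewrite Cmod_mult, Hu, Rmult_1_l.
  assert (H := Cmod_v_le b1 b2 (RtoC r * u)).
  rewrite (Cmod_mult (RtoC r)), Hu, Cmod_R, Rabs_right, Rmult_1_r in H by lra; exact H. }
assert (Hl' : is_RInt_ray (fun r : R => v b1 b2 (RtoC r * u) * Cexp (- (x * (RtoC r * u))) * u) l).
{ revert Hl; apply is_RInt_ray_ext; intros r _; ring. }
clear Hl.
set (z := - ((b2 - b1) / x)).
(* With z = - b / x the k-th integrated term is - z^{k+1} / ((k + 1)! b), so the sum up to k = n
   uses the exponential series through degree n + 1. *)
assert (E : forall n, Csum (fun k => v_coeff (b2 - b1) k * (RtoC (INR (fact k)) / x ^ S k)) n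
  = (1 - Cexp z + exp_rem (S (S n)) z) / (b2 - b1) :> C).
{ intros n; induction n as [|n IH].
  - rewrite Csum_0.
    replace (exp_rem 2 z) with (Cexp z - 1 - z)
      by (simpl; field; intros H; apply RtoC_inj in H; lra).
    unfold v_coeff, z; generalize (Cexp (- ((b2 - b1) / x))); intros e; simpl.
    rewrite Rmult_1_r; field.
    repeat split; try easy; intros H; apply RtoC_inj in H; lra.
  - rewrite Csum_S, IH.
    change (exp_rem (S (S (S n))) z) with
      (exp_rem (S (S n)) z - z ^ (S (S n)) / RtoC (INR (fact (S (S n))))).
    unfold v_coeff.
    replace (z ^ S (S n)) with (- (1) * (- (1)) ^ S n * ((b2 - b1) * (b2 - b1) ^ S n) / x ^ S (S n)).
    2: { unfold z; replace (- ((b2 - b1) / x)) with (- (1) * (b2 - b1) * / x) by (field; easy).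
         rewrite 2!Cpow_mult_l, Cpow_inv, (Cpow_S (- (1)) (S n)), (Cpow_S (b2 - b1) (S n)) by easy.
         unfold Cdiv; ring. }
    rewrite RtoC_mult; field.
    repeat split; try easy; try apply INR_fact_C_neq_0; now apply (Cpow_nz x (S (S n))). }
(* Two errors of order 1 / (n + 1): that of termwise integration, and the exponential remainder, in
   which |z|^{n+1} / (n + 1)! is bounded by e^{|z|}. *)
set (K := (1 / (Re (x * u) - Cmod (b2 - b1)) +
  Cmod z * exp (Cmod z) * exp (Cmod z) / Cmod (b2 - b1))%R).
replace ((1 - Cexp z) / (b2 - b1)) with l; [exact Hl'|].
assert (H0 : l - (1 - Cexp z) / (b2 - b1) = 0).
2: { replace l with (l - (1 - Cexp z) / (b2 - b1) + (1 - Cexp z) / (b2 - b1)) by ring.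
     rewrite H0; ring. }
apply (Cmod_eq_0_inv_nat _ K); intros n.
assert (Hn : (0 < INR (S n))%R) by (apply lt_0_INR; lia).
assert (H1 := Cmod_v_integral_minus_sum_le b1 b2 x u l (fun _ => u) 1 _ n Hu Hx
  (fun r _ => Req_le _ _ Hu)
  (fun k => is_RInt_ray_moment x u k Hu (Rlt_trans _ _ _ Hbp Hx)) Hl').
rewrite E in H1.
assert (H2 := Cmod_exp_rem_le (S (S n)) z).
replace (l - (1 - Cexp z) / (b2 - b1)) with
  (l - (1 - Cexp z + exp_rem (S (S n)) z) / (b2 - b1) + exp_rem (S (S n)) z / (b2 - b1)) by (field; easy).
apply Rle_trans with (1 := Cmod_triangle _ _).
unfold K; rewrite Rdiv_plus_distr; apply Rplus_le_compat; [exact H1|].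
rewrite Cmod_div by easy.
replace (_ / _ / INR (S n))%R with (Cmod z * exp (Cmod z) * exp (Cmod z) / INR (S n) / Cmod (b2 - b1))%R
  by (field; lra).
apply Rmult_le_compat_r; [apply Rlt_le, Rinv_0_lt_compat; lra|].
apply Rle_trans with (1 := H2).
replace (_ / INR (S n))%R with (Cmod z * exp (Cmod z) / INR (S n) * exp (Cmod z))%R by (field; lra).
apply Rmult_le_compat_r; [apply Rlt_le, exp_pos|].
assert (Hz := Cmod_ge_0 z).
assert (H3 := pow_div_fact_le_exp (Cmod z) (S n) Hz).
rewrite fact_simpl, mult_INR.
change (Cmod z ^ S (S n))%R with (Cmod z * Cmod z ^ S n)%R.
assert (Hf := INR_fact_lt_0 (S n)).
assert (HSS : (INR (S n) < INR (S (S n)))%R) by (apply lt_INR; lia).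
replace (Cmod z * Cmod z ^ S n / (INR (S (S n)) * INR (fact (S n))))%R
  with (Cmod z * (Cmod z ^ S n / INR (fact (S n))) * / INR (S (S n)))%R by (field; lra).
apply Rmult_le_compat.
- apply Rmult_le_pos; [easy|]. apply Rdiv_le_0_compat; [now apply pow_le|easy].
- apply Rlt_le, Rinv_0_lt_compat; lra.
- now apply Rmult_le_compat_l.
- apply Rinv_le_contravar; lra.
Qed.

(** * The fundamental matrix at infinity *)

Lemma Cminus_neq_0 (a b : C) : a <> b -> b - a <> 0.
Proof. intros H H0; apply H; replace b with ((b - a) + a) by ring; rewrite H0; ring. Qed.

Lemma neq_0_of_Re_mult_gt (x u : C) (a : R) : (0 <= a)%R -> (a < Re (x * u))%R -> x <> 0.
Proof.
intros Ha H H0; rewrite H0, Cmult_0_l in H; unfold Re in H; simpl in H; lra.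
Qed.

Lemma im_le_Cmod (z : C) : (Rabs (Im z) <= Cmod z)%R.
Proof. apply Rle_trans with (2 := Rmax_Cmod z), Rmax_r. Qed.

(** Write the denominator as 1 - r k. If Re k <= 0, its real part is at least 1. Otherwise Im k is
    nonzero, since a positive real k gives a zero at r = 1 / k, and the distance from 1 to the line
    through 0 and k is |Im k| / |k|. *)
Lemma laplace_denominator_bound (g1 g2 u : C) :
  (forall r : R, (0 < r)%R -> laplace_denominator g1 g2 (RtoC r * u) <> 0) ->
  exists m : R, (0 < m)%R /\ forall r : R, (0 <= r)%R ->
    (m <= Cmod (laplace_denominator g1 g2 (RtoC r * u)))%R.
Proof.
intros H; unfold laplace_denominator in *.
set (k := u / (g2 - g1)).
assert (E : forall r : R, 1 - RtoC r * u / (g2 - g1) = 1 - RtoC r * k)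
  by (intros r; unfold k, Cdiv; ring).
setoid_rewrite E; setoid_rewrite E in H; clearbody k; clear E.
destruct (Rle_dec (Re k) 0) as [Hk|Hk].
- exists 1%R; split; [lra|]; intros r Hr.
  apply Rle_trans with (2 := Re_le_Cmod _).
  replace (Re (1 - RtoC r * k)) with (1 - r * Re k)%R by (unfold Re; simpl; ring).
  nra.
- assert (Hi : Im k <> 0%R).
  { intros Hi; apply (H (/ Re k)%R); [apply Rinv_0_lt_compat; lra|].
    apply injective_projections; unfold Re, Im in *; simpl; rewrite Hi; field; lra. }
  assert (Hk0 : (0 < Cmod k)%R).
  { apply Rlt_le_trans with (2 := Re_le_Cmod k); lra. }
  exists (Rabs (Im k) / Cmod k)%R; split.
  { apply Rdiv_lt_0_compat; [now apply Rabs_pos_lt|easy]. }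
  intros r _; apply Rle_div_l; [easy|].
  (* Multiplying by the conjugate of [k] makes the imaginary part independent of [r]. *)
  rewrite <- (Cmod_conj k), <- Cmod_mult.
  apply Rle_trans with (2 := im_le_Cmod _); right.
  rewrite <- Rabs_Ropp; f_equal; unfold Im; simpl; ring.
Qed.

Lemma not_singular_denominator (g1 g2 : C) (theta r : R) :
  g1 <> g2 -> ~ singular_direction_inf g1 g2 theta -> (0 <= r)%R ->
  laplace_denominator g1 g2 (RtoC r * Cexpi theta) <> 0.
Proof.
intros Hg Hs [Hr|<-] H.
- apply Hs; split; [easy|now exists r].
- unfold laplace_denominator in H.
  replace (1 - RtoC 0 * Cexpi theta / (g2 - g1)) with (RtoC 1) in H by (unfold Cdiv; ring).
  apply RtoC_inj in H; lra.
Qed.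

Lemma continuous_inv_denominator (g1 g2 u : C) (r : R) :
  laplace_denominator g1 g2 (RtoC r * u) <> 0 ->
  continuous (U := C_UniformSpace) (fun r : R => / laplace_denominator g1 g2 (RtoC r * u)) r.
Proof.
intros H; apply continuous_RC_inv; [|easy].
apply (continuous_plus (K := R_AbsRing) (V := C_R_NormedModule)).
- apply (continuous_const (V := C_UniformSpace)).
- apply (continuous_opp (K := R_AbsRing) (V := C_R_NormedModule)).
  apply continuous_RC_mult; [apply continuous_ray|].
  apply (continuous_const (V := C_UniformSpace)).
Qed.

Section Omega.

Variables (b1 b2 g1 g2 : C) (theta : R).
Hypothesis hb : b1 <> b2.
Hypothesis hg : g1 <> g2.
Hypothesis hs : ~ singular_direction_inf g1 g2 theta.

Let phi (r : R) : C :=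
  v b1 b2 (RtoC r * Cexpi theta) * (/ laplace_denominator g1 g2 (RtoC r * Cexpi theta)) *
  Cexpi theta.

Lemma omega_kernel_bounded : exists M : R, forall r : R, (0 <= r)%R ->
  (Cmod (phi r) <= M * exp (Cmod (b2 - b1) * r))%R.
Proof.
destruct (laplace_denominator_bound g1 g2 (Cexpi theta)) as [m [Hm H]].
{ intros r Hr; apply Rlt_le in Hr; now apply not_singular_denominator. }
exists (2 / m)%R; intros r Hr; unfold phi.
specialize (H r Hr).
rewrite 2!Cmod_mult, Cmod_inv, Cmod_Cexpi, Rmult_1_r by (apply Cmod_gt_0; lra).
assert (Hv := Cmod_v_le b1 b2 (RtoC r * Cexpi theta)).
rewrite (Cmod_mult (RtoC r)), Cmod_Cexpi, Cmod_R, Rabs_right, Rmult_1_r in Hv by lra.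
replace (2 / m * exp (Cmod (b2 - b1) * r))%R with (2 * exp (Cmod (b2 - b1) * r) * / m)%R
  by (unfold Rdiv; ring).
apply Rmult_le_compat; [apply Cmod_ge_0| |easy|].
- apply Rlt_le, Rinv_0_lt_compat; lra.
- now apply Rinv_le_contravar.
Qed.

Lemma continuous_omega_kernel (r : R) : (0 <= r)%R ->
  continuous (U := C_UniformSpace) phi r.
Proof.
intros Hr; apply continuous_RC_mult; [apply continuous_RC_mult|].
- apply continuous_v_ray.
- now apply continuous_inv_denominator, not_singular_denominator.
- apply (continuous_const (V := C_UniformSpace)).
Qed.

(** [RInt_gen] returns a value even for a divergent integral, so [omega] carries information only
    once convergence is known. *)
Lemma is_RInt_ray_omega (x : C) : (Cmod (b2 - b1) < Re (x * Cexpi theta))%R ->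
  is_RInt_ray (fun r : R => phi r * Cexp (- (x * (RtoC r * Cexpi theta))))
    (omega b1 b2 g1 g2 theta x).
Proof.
intros Hx.
destruct omega_kernel_bounded as [M HM].
destruct (ex_laplace phi M (Cmod (b2 - b1)) (Cexpi theta) continuous_omega_kernel HM x Hx) as [l Hl].
replace (omega b1 b2 g1 g2 theta x) with l; [exact Hl|].
unfold omega; destruct (Ceq_dec g1 g2) as [H|_]; [easy|].
symmetry; apply (is_RInt_gen_unique (V := C_R_CompleteNormedModule)).
revert Hl; apply is_RInt_ray_ext; intros r _.
unfold phi, laplace_integrand, Cdiv; ring.
Qed.

Lemma is_RInt_ray_laplace_integrand (x : C) : (Cmod (b2 - b1) < Re (x * Cexpi theta))%R ->
  is_RInt_ray (laplace_integrand b1 b2 g1 g2 theta x) (omega b1 b2 g1 g2 theta x).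
Proof.
intros Hx; generalize (is_RInt_ray_omega x Hx); apply is_RInt_ray_ext; intros r _.
unfold phi, laplace_integrand, Cdiv; ring.
Qed.

(* [- p / (1 - p / g) = g - g / (1 - p / g)] turns the differentiated integrand
   into a multiple of the original one plus the Laplace transform of [v]. *)
Lemma is_Cderive_omega (x : C) : (Cmod (b2 - b1) < Re (x * Cexpi theta))%R ->
  is_Cderive (omega b1 b2 g1 g2 theta) x
    ((g2 - g1) * ((1 - Cexp (- ((b2 - b1) / x))) / (b2 - b1))
      - (g2 - g1) * omega b1 b2 g1 g2 theta x).
Proof.
intros Hx.
assert (Hg0 := Cminus_neq_0 _ _ hg).
destruct omega_kernel_bounded as [M HM].
apply (is_Cderive_laplace phi M (Cmod (b2 - b1)) (Cexpi theta) HM (Cmod_Cexpi theta)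
  (omega b1 b2 g1 g2 theta) x _ is_RInt_ray_omega Hx).
generalize (is_RInt_ray_minus _ _ _ _
  (is_RInt_ray_scal _ (g2 - g1) _ (is_RInt_ray_v b1 b2 x _ hb (Cmod_Cexpi theta) Hx))
  (is_RInt_ray_scal _ (g2 - g1) _ (is_RInt_ray_omega x Hx))).
apply is_RInt_ray_ext; intros r Hr; unfold phi.
assert (Hd := not_singular_denominator g1 g2 theta r hg hs Hr).
set (d := laplace_denominator g1 g2 (RtoC r * Cexpi theta)) in *.
replace (- (RtoC r * Cexpi theta)) with ((g2 - g1) * (d - 1))
  by (unfold d, laplace_denominator; field; easy).
field; easy.
Qed.

End Omega.

Lemma is_Cderive_Cexp_scal (g x : C) :
  is_Cderive (fun y => Cexp (g * y)) x (g * Cexp (g * x)).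
Proof.
apply (is_Cderive_comp Cexp (fun y => g * y)); [apply is_Cderive_Cexp|].
apply (is_Cderive_eq _ _ _ _ (is_Cderive_scal g _ _ _ (is_Cderive_id x))); ring.
Qed.

Lemma is_Cderive_Cexp_inv (b x : C) : x <> 0 ->
  is_Cderive (fun y => Cexp (- (b / y))) x (b / x ^ 2 * Cexp (- (b / x))).
Proof.
intros Hx; apply (is_Cderive_comp Cexp (fun y => - (b / y))); [apply is_Cderive_Cexp|].
apply (is_Cderive_ext (fun y => - b * / y)); [intros y; unfold Cdiv; ring|].
apply (is_Cderive_eq _ _ _ _ (is_Cderive_scal (- b) _ _ _ (is_Cderive_inv x Hx))).
field; easy.
Qed.

Lemma mul22_mk22 (a b c d a' b' c' d' : C) :
  mul22 (mk22 a b c d) (mk22 a' b' c' d') =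
  mk22 (a * a' + b * c') (a * b' + b * d') (c * a' + d * c') (c * b' + d * d').
Proof.
unfold mul22, mk22, Mmult, mk_matrix, sum_n, sum_n_m.
cbn -[Cplus Cmult RtoC].
now rewrite 4!Cplus_0_r.
Qed.

Lemma one22_mk22 : one22 = mk22 1 0 0 1.
Proof. reflexivity. Qed.

Definition P12_inf (b1 b2 g1 g2 : C) (theta : R) (x : C) : C :=
  (Cexp (- ((b2 - b1) / x)) - 1) / (b2 - b1) + omega b1 b2 g1 g2 theta x.

Lemma Phi_inf_mk22 (b1 b2 g1 g2 : C) (theta : R) (x : C) :
  Phi_inf b1 b2 g1 g2 theta x =
  mk22 (Cexp (- (b1 / x)) * Cexp (g1 * x))
       (Cexp (- (b1 / x)) * P12_inf b1 b2 g1 g2 theta x * Cexp (g2 * x))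
       0 (Cexp (- (b2 / x)) * (1 / x) ^ 2 * Cexp (g2 * x)).
Proof.
unfold Phi_inf, diag22, P_inf; rewrite 3!mul22_mk22; unfold P12_inf; f_equal; ring.
Qed.

Lemma dom_inf_neq_0 (b1 b2 g1 g2 : C) (theta : R) (x : C) :
  dom_inf b1 b2 g1 g2 theta x -> x <> 0.
Proof.
unfold dom_inf; destruct (Ceq_dec g1 g2); [easy|].
apply neq_0_of_Re_mult_gt, Cmod_ge_0.
Qed.

(** The term g (1 - e^{-b/x}) / b in the derivative of [omega] completes - g [omega] to - g
    [P12_inf]. If g1 = g2, both [omega] and g are 0 and the formula persists. *)
Lemma is_Cderive_P12_inf (b1 b2 g1 g2 : C) (theta : R) (x : C) : b1 <> b2 ->
  ~ singular_direction_inf g1 g2 theta -> dom_inf b1 b2 g1 g2 theta x ->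
  is_Cderive (P12_inf b1 b2 g1 g2 theta) x
    (Cexp (- ((b2 - b1) / x)) / x ^ 2 - (g2 - g1) * P12_inf b1 b2 g1 g2 theta x).
Proof.
intros hb hs Hx.
assert (Hx0 := dom_inf_neq_0 _ _ _ _ _ _ Hx).
assert (Hb0 := Cminus_neq_0 _ _ hb).
assert (H1 : is_Cderive (fun y => (Cexp (- ((b2 - b1) / y)) - 1) / (b2 - b1)) x
  (Cexp (- ((b2 - b1) / x)) / x ^ 2)).
{ apply (is_Cderive_ext (fun y => / (b2 - b1) * (Cexp (- ((b2 - b1) / y)) + - (1)))).
  { intros y; unfold Cdiv; ring. }
  eapply is_Cderive_eq.
  - apply is_Cderive_scal, is_Cderive_plus; [now apply is_Cderive_Cexp_inv|apply is_Cderive_const].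
  - field; easy. }
eapply is_Cderive_eq.
- apply is_Cderive_plus; [exact H1|].
  instantiate (1 := (g2 - g1) * ((1 - Cexp (- ((b2 - b1) / x))) / (b2 - b1))
      - (g2 - g1) * omega b1 b2 g1 g2 theta x).
  revert Hx; unfold dom_inf; destruct (Ceq_dec g1 g2) as [<-|Hg]; intros Hx.
  + apply (is_Cderive_ext (fun _ => 0)).
    { intros y; unfold omega; now destruct (Ceq_dec g1 g1). }
    apply (is_Cderive_eq _ _ _ _ (is_Cderive_const 0 x)); ring.
  + now apply is_Cderive_omega.
- unfold P12_inf; field; easy.
Qed.

Lemma dom_inf_nonempty (b1 b2 g1 g2 : C) (theta : R) :
  exists x : C, dom_inf b1 b2 g1 g2 theta x.
Proof.
unfold dom_inf; destruct (Ceq_dec g1 g2).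
- exists 1; intros H; apply RtoC_inj in H; lra.
- exists (RtoC (Cmod (b2 - b1) + 1) * Cexpi (- theta)).
  rewrite <- Cmult_assoc, <- Cexpi_add, Rplus_opp_l, Re_scal, Cexpi_eq, cos_0.
  simpl; lra.
Qed.

Lemma inv_pow_neq_0 (x : C) (n : nat) : x <> 0 -> (1 / x) ^ n <> 0.
Proof.
intros Hx; apply Cpow_nz; intros H.
apply (f_equal (Cmult x)) in H; rewrite Cmult_0_r in H.
replace (x * (1 / x)) with (RtoC 1) in H by (field; easy).
apply RtoC_inj in H; lra.
Qed.

(** The equation for [P12_inf], multiplied by e^{-b1/x} e^{g2 x}, is L_1 Phi12 = Phi2: its term - g
    [P12_inf] turns the rate g2 into g1. *)
Lemma Phi_inf_fundamental (b1 b2 g1 g2 : C) (theta : R) : b1 <> b2 ->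
  ~ singular_direction_inf g1 g2 theta ->
  is_fundamental_matrix b1 b2 g1 g2 (dom_inf b1 b2 g1 g2 theta)
    (Phi_inf b1 b2 g1 g2 theta).
Proof.
intros hb hs.
assert (E00 : forall x, ent (Phi_inf b1 b2 g1 g2 theta x) 0 0 =
  Cexp (- (b1 / x)) * Cexp (g1 * x)) by (intros x; rewrite Phi_inf_mk22; reflexivity).
assert (E01 : forall x, ent (Phi_inf b1 b2 g1 g2 theta x) 0 1 =
  Cexp (- (b1 / x)) * P12_inf b1 b2 g1 g2 theta x * Cexp (g2 * x))
  by (intros x; rewrite Phi_inf_mk22; reflexivity).
assert (E11 : forall x, ent (Phi_inf b1 b2 g1 g2 theta x) 1 1 =
  Cexp (- (b2 / x)) * (1 / x) ^ 2 * Cexp (g2 * x))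
  by (intros x; rewrite Phi_inf_mk22; reflexivity).
refine (conj _ (conj _ (conj _ (conj _ (conj _ _))))).
- intros x _; rewrite Phi_inf_mk22; reflexivity.
- intros x Hx; apply dom_inf_neq_0 in Hx.
  apply (is_Cderive_ext (fun x => Cexp (- (b1 / x)) * Cexp (g1 * x))); [now intros y|].
  eapply is_Cderive_eq.
  + apply is_Cderive_mult; [now apply is_Cderive_Cexp_inv|apply is_Cderive_Cexp_scal].
  + rewrite E00; ring.
- intros x Hx; apply dom_inf_neq_0 in Hx.
  apply (is_Cderive_ext (fun x => Cexp (- (b2 / x)) * (/ x * / x) * Cexp (g2 * x))).
  { intros y; rewrite E11; unfold Cdiv; ring. }
  eapply is_Cderive_eq.
  + apply is_Cderive_mult; [apply is_Cderive_mult; [now apply is_Cderive_Cexp_inv|]|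
      apply is_Cderive_Cexp_scal].
    apply is_Cderive_mult; now apply is_Cderive_inv.
  + rewrite E11; field; easy.
- intros x Hx; assert (Hx0 := dom_inf_neq_0 _ _ _ _ _ _ Hx).
  apply (is_Cderive_ext (fun x => Cexp (- (b1 / x)) * P12_inf b1 b2 g1 g2 theta x * Cexp (g2 * x)));
    [now intros y|].
  eapply is_Cderive_eq.
  + apply is_Cderive_mult; [apply is_Cderive_mult; [now apply is_Cderive_Cexp_inv|]|
      apply is_Cderive_Cexp_scal].
    now apply is_Cderive_P12_inf.
  + rewrite E01, E11.
    replace (- (b2 / x)) with (- (b1 / x) + - ((b2 - b1) / x)) by (field; easy).
    rewrite Cexp_add; field; easy.
- destruct (dom_inf_nonempty b1 b2 g1 g2 theta) as [x Hx]; exists x; split; [easy|].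
  rewrite E00; apply Cmult_neq_0; apply Cexp_neq_0.
- destruct (dom_inf_nonempty b1 b2 g1 g2 theta) as [x Hx]; exists x; split; [easy|].
  apply dom_inf_neq_0 in Hx.
  rewrite E11; apply Cmult_neq_0; [apply Cmult_neq_0|]; try apply Cexp_neq_0.
  now apply inv_pow_neq_0.
Qed.

(** * Integrals of a simple pole over a triangle *)

(** With [0, 1] cut into n + 1 equal parts the increments add up to at most K / (n + 1). This takes
    the place of a vanishing derivative, so the pole integrals are not differentiated in t. *)
Lemma eq_of_quadratic_increments (T : R -> C) (K : R) :
  (forall s t : R, (0 <= s <= 1)%R -> (0 <= t <= 1)%R ->
     (Cmod (T s - T t)%C <= K * (s - t) ^ 2)%R) ->
  T 1%R = T 0%R.
Proof.
intros H.
assert (H0 : T 1%R - T 0%R = 0).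
2: { replace (T 1%R) with (T 1%R - T 0%R + T 0%R) by ring; rewrite H0; ring. }
apply (Cmod_eq_0_inv_nat _ K); intros n.
assert (Hn : (0 < INR (S n))%R) by (apply lt_0_INR; lia).
assert (Q : forall k : nat, (k <= S n)%nat ->
  (Cmod (T (INR k / INR (S n))%R - T 0%R)%C <= INR k * (K / (INR (S n) * INR (S n))))%R).
{ induction k as [|k IH]; intros Hk.
  - rewrite Rdiv_0_l; unfold Cminus; rewrite Cplus_opp_r, Cmod_0; simpl; lra.
  - replace (T (INR (S k) / INR (S n))%R - T 0%R) with
     ((T (INR (S k) / INR (S n))%R - T (INR k / INR (S n))%R) + (T (INR k / INR (S n))%R - T 0%R)) by ring.
    apply Rle_trans with (1 := Cmod_triangle _ _).
    assert (Hb : forall j, (j <= S n)%nat -> (0 <= INR j / INR (S n) <= 1)%R).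
    { intros j Hj; split.
      - apply Rdiv_le_0_compat; [apply pos_INR|easy].
      - apply Rle_div_l; [easy|]; rewrite Rmult_1_l; now apply le_INR. }
    specialize (H _ _ (Hb (S k) Hk) (Hb k ltac:(lia))).
    replace (K * (INR (S k) / INR (S n) - INR k / INR (S n)) ^ 2)%R
      with (K / (INR (S n) * INR (S n)))%R in H by (rewrite (S_INR k); field; lra).
    specialize (IH ltac:(lia)).
    apply Rle_trans with (1 := Rplus_le_compat _ _ _ _ H IH).
  right; rewrite (S_INR k); ring. }
specialize (Q (S n) ltac:(lia)).
rewrite Rdiv_diag in Q by lra.
replace (K / INR (S n))%R with (INR (S n) * (K / (INR (S n) * INR (S n))))%R by (field; lra).
exact Q.
Qed.

(** The case y = 0 is included because the homotopy parameter starts at t = 0. *)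
Lemma ex_primitive_Cexp (y g : C) :
  exists Phi : C -> C, forall p : C, is_Cderive Phi p (Cexp (y * (g - p))).
Proof.
destruct (Ceq_dec y 0) as [->|Hy].
- exists (fun p => p); intros p; apply (is_Cderive_eq _ _ _ _ (is_Cderive_id p)).
  now rewrite Cmult_0_l, Cexp_0.
- exists (fun p => - Cexp (y * g) / y * Cexp (- y * p)); intros p.
  apply (is_Cderive_eq _ _ _ _ (is_Cderive_scal _ _ _ _ (is_Cderive_Cexp_scal (- y) p))).
  replace (y * (g - p)) with (y * g + - y * p) by ring.
  rewrite Cexp_add; field; easy.
Qed.

(* [exp (t y (g - p)) / (g - p)] along the segment [p = a + r d]; [t] runs from [0],
   where the integral is elementary, to [1]. *)
Definition pole_integrand (y g a d : C) (t r : R) : C :=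
  d * (Cexp (RtoC t * y * (g - (a + RtoC r * d))) / (g - (a + RtoC r * d))).

Lemma continuous_line (a d : C) (r : R) :
  continuous (U := C_UniformSpace) (fun r : R => a + RtoC r * d) r.
Proof. eapply (is_Cderive_continuous_line (fun p => p)), is_Cderive_id. Qed.

Lemma continuous_Cexp_line (y g a d : C) (r : R) :
  continuous (U := C_UniformSpace) (fun r : R => Cexp (y * (g - (a + RtoC r * d)))) r.
Proof.
apply (continuous_ext (T := R_UniformSpace) (U := C_UniformSpace)
  (fun r : R => Cexp (y * (g - a) + RtoC r * (- y * d)))).
{ intros s; f_equal; ring. }
eapply (is_Cderive_continuous_line Cexp), is_Cderive_Cexp.
Qed.

Lemma ex_pole_integral (y g a d : C) (t l : R) : (0 <= l)%R ->
  (forall r : R, (0 <= r <= l)%R -> g - (a + RtoC r * d) <> 0) ->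
  is_RIntC (pole_integrand y g a d t) 0 l
    (RInt (V := C_R_CompleteNormedModule) (pole_integrand y g a d t) 0 l).
Proof.
intros Hl H0; apply (RInt_correct (V := C_R_CompleteNormedModule)).
apply ex_RIntC_continuous; [easy|]; intros r Hr.
apply continuous_RC_mult; [apply (continuous_const (V := C_UniformSpace))|].
apply continuous_RC_mult; [apply continuous_Cexp_line|].
apply continuous_RC_inv; [|now apply H0].
apply (continuous_minus (K := R_AbsRing) (V := C_R_NormedModule)).
- apply (continuous_const (V := C_UniformSpace)).
- apply continuous_line.
Qed.

(** The increment of e^{t y q} / q has linear part (s - t) y e^{t y q}, which is entire in p and is
    integrated by [Phi]; what remains is quadratic, and one of its factors q cancels the pole. [K]
    is chosen before [Phi], since the primitive varies with t. *)
Lemma pole_integral_increment (y g a d : C) (l Q : R) : (0 <= l)%R ->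
  (forall r : R, (0 <= r <= l)%R -> g - (a + RtoC r * d) <> 0) ->
  (forall r : R, (0 <= r <= l)%R -> (Cmod (g - (a + RtoC r * d)) <= Q)%R) ->
  exists K : R, forall (s t : R) (Phi : C -> C) (ls lt : C),
    (0 <= s <= 1)%R -> (0 <= t <= 1)%R ->
    (forall p : C, is_Cderive Phi p (Cexp (RtoC t * y * (g - p)))) ->
    is_RIntC (pole_integrand y g a d s) 0 l ls ->
    is_RIntC (pole_integrand y g a d t) 0 l lt ->
    (Cmod (ls - lt - RtoC (s - t) * y * (Phi (a + RtoC l * d) - Phi a))%C <= K * (s - t) ^ 2)%R.
Proof.
intros Hl H0 HQ.
(* Bounds both the exponential at t and the one in the Taylor remainder, whose exponents have
   modulus at most |y| Q. *)
set (E := exp (Cmod y * Q)).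
exists (l * (Cmod d * (E * (Cmod y ^ 2 * Q * E))))%R.
intros s t Phi ls lt Hs Ht HPhi Hls Hlt.
assert (HP : is_RIntC (fun r : R => d * Cexp (RtoC t * y * (g - (a + RtoC r * d)))) 0 l
  (Phi (a + RtoC l * d) - Phi a)).
{ replace (Phi a) with (Phi (a + RtoC 0 * d)) by (f_equal; ring).
  apply (is_RIntC_derive (fun r : R => Phi (a + RtoC r * d))); [easy| |].
  - intros r _; apply is_Rderive_comp_line, HPhi.
  - intros r _; apply continuous_RC_mult; [apply (continuous_const (V := C_UniformSpace))|].
    apply continuous_Cexp_line. }
assert (HI := is_RInt_minus (V := C_R_NormedModule) _ _ _ _ _ _
  (is_RInt_minus (V := C_R_NormedModule) _ _ _ _ _ _ Hls Hlt)
  (is_RIntC_scal _ _ _ (RtoC (s - t) * y) _ HP)).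
replace (_ * _ * _)%R with ((l - 0) * (Cmod d * (E * (Cmod y ^ 2 * Q * E)) * (s - t) ^ 2))%R by ring.
refine (Cmod_RInt_le_const _ _ _ _ _ Hl _ HI).
intros r Hr; specialize (H0 r Hr); specialize (HQ r Hr).
unfold pole_integrand; set (q := g - (a + RtoC r * d)) in *.
match goal with |- (Cmod ?e <= _)%R => replace e with
  (d * (Cexp (RtoC t * y * q) * ((Cexp (RtoC (s - t) * y * q) - 1 - RtoC (s - t) * y * q) / q))) end.
2: { match goal with |- _ = minus (minus ?A ?B) ?D =>
       change (minus (minus A B) D) with (A - B - D) end.
     replace (RtoC s * y * q) with (RtoC t * y * q + RtoC (s - t) * y * q)
       by (rewrite RtoC_minus; ring).
     rewrite Cexp_add; field; easy. }
assert (Hq := Cmod_ge_0 q). assert (Hy := Cmod_ge_0 y).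
assert (Hm : forall z, (-1 <= z <= 1)%R -> (Cmod (RtoC z * y * q) <= Cmod y * Q)%R).
{ intros z Hz; rewrite 2!Cmod_mult, Cmod_R.
  apply Rle_trans with (1 * Cmod y * Q)%R; [|lra].
  apply Rmult_le_compat; [|easy| |easy].
  - apply Rmult_le_pos; [apply Rabs_pos|easy].
  - apply Rmult_le_compat_r; [easy|]; now apply Rabs_le. }
rewrite 2!Cmod_mult, Cmod_div, (Rmult_assoc (Cmod d)) by easy.
apply Rmult_le_compat_l; [apply Cmod_ge_0|].
rewrite (Rmult_assoc E).
assert (HE : forall z, (-1 <= z <= 1)%R -> (exp (Cmod (RtoC z * y * q)) <= E)%R)
  by (intros z Hz; apply exp_le; now apply Hm).
apply Rmult_le_compat; [apply Cmod_ge_0|apply Rdiv_le_0_compat; [apply Cmod_ge_0|now apply Cmod_gt_0]| |].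
- apply Rle_trans with (1 := Cmod_Cexp_le _), HE; lra.
- apply Rle_div_l; [now apply Cmod_gt_0|].
  apply Rle_trans with (1 := Cmod_exp_rem_2_le _).
  apply Rle_trans with (Cmod (RtoC (s - t) * y * q) * Cmod (RtoC (s - t) * y * q) * E)%R.
  + apply Rmult_le_compat_l; [apply Rle_0_sqr|apply HE; lra].
  + rewrite 2!Cmod_mult, Cmod_R.
    replace (Rabs (s - t) * Cmod y * Cmod q * (Rabs (s - t) * Cmod y * Cmod q) * E)%R
      with (Cmod y ^ 2 * Cmod q * E * (Rabs (s - t)) ^ 2 * Cmod q)%R by ring.
    rewrite pow2_abs.
    apply Rmult_le_compat_r; [easy|].
    apply Rmult_le_compat_r; [apply pow2_ge_0|].
    apply Rmult_le_compat_r; [apply Rlt_le, exp_pos|].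
    apply Rmult_le_compat_l; [apply pow2_ge_0|easy].
Qed.

Lemma pole_bounded (g a d : C) (l r : R) : (0 <= r <= l)%R ->
  (Cmod (g - (a + RtoC r * d)) <= Cmod g + Cmod a + l * Cmod d)%R.
Proof.
intros Hr; unfold Cminus; apply Rle_trans with (1 := Cmod_triangle _ _).
rewrite Cmod_opp, Rplus_assoc; apply Rplus_le_compat_l.
apply Rle_trans with (1 := Cmod_triangle _ _); apply Rplus_le_compat_l.
rewrite Cmod_mult, Cmod_R, Rabs_right by lra.
apply Rmult_le_compat_r; [apply Cmod_ge_0|lra].
Qed.

(* The [t]-derivative of the integrand is entire, so the integral over the closed
   triangle with vertices [0], [l u1], [l u2] does not depend on [t]. *)
Lemma triangle_pole_integral (y g u1 u2 d : C) (l m : R) :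
  (0 <= l)%R -> (0 <= m)%R -> RtoC l * u1 + RtoC m * d = RtoC l * u2 ->
  (forall r : R, (0 <= r <= l)%R -> g - (0 + RtoC r * u1) <> 0) ->
  (forall r : R, (0 <= r <= l)%R -> g - (0 + RtoC r * u2) <> 0) ->
  (forall r : R, (0 <= r <= m)%R -> g - (RtoC l * u1 + RtoC r * d) <> 0) ->
  exists T : R -> C * C * C,
    (forall t : R,
      is_RIntC (pole_integrand y g 0 u1 t) 0 l (fst (fst (T t))) /\
      is_RIntC (pole_integrand y g 0 u2 t) 0 l (snd (fst (T t))) /\
      is_RIntC (pole_integrand y g (RtoC l * u1) d t) 0 m (snd (T t))) /\
    fst (fst (T 1%R)) - snd (fst (T 1%R)) + snd (T 1%R) =
    fst (fst (T 0%R)) - snd (fst (T 0%R)) + snd (T 0%R).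
Proof.
intros Hl Hm Hclose H1 H2 H3.
set (A := fun t => RInt (V := C_R_CompleteNormedModule) (pole_integrand y g 0 u1 t) 0 l : C).
set (B := fun t => RInt (V := C_R_CompleteNormedModule) (pole_integrand y g 0 u2 t) 0 l : C).
set (D := fun t => RInt (V := C_R_CompleteNormedModule) (pole_integrand y g (RtoC l * u1) d t) 0 m : C).
assert (HA : forall t, is_RIntC (pole_integrand y g 0 u1 t) 0 l (A t))
  by (intros t; now apply ex_pole_integral).
assert (HB : forall t, is_RIntC (pole_integrand y g 0 u2 t) 0 l (B t))
  by (intros t; now apply ex_pole_integral).
assert (HD : forall t, is_RIntC (pole_integrand y g (RtoC l * u1) d t) 0 m (D t))
  by (intros t; now apply ex_pole_integral).
exists (fun t => (A t, B t, D t)); simpl; split; [easy|].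
destruct (pole_integral_increment y g 0 u1 l _ Hl H1 (pole_bounded g 0 u1 l)) as [K1 HK1].
destruct (pole_integral_increment y g 0 u2 l _ Hl H2 (pole_bounded g 0 u2 l)) as [K2 HK2].
destruct (pole_integral_increment y g (RtoC l * u1) d m _ Hm H3
  (pole_bounded g (RtoC l * u1) d m)) as [K3 HK3].
apply (eq_of_quadratic_increments (fun t => A t - B t + D t) (K1 + K2 + K3)).
intros s t Hs Ht.
destruct (ex_primitive_Cexp (RtoC t * y) g) as [Phi HPhi].
specialize (HK1 s t Phi _ _ Hs Ht HPhi (HA s) (HA t)).
specialize (HK2 s t Phi _ _ Hs Ht HPhi (HB s) (HB t)).
specialize (HK3 s t Phi _ _ Hs Ht HPhi (HD s) (HD t)).
(* The third side runs from l u1 to l u2, so the values of [Phi] cancel around the triangle. *)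
rewrite Hclose in HK3; rewrite Cplus_0_l in HK1, HK2.
set (X1 := A s - A t - _) in HK1; set (X2 := B s - B t - _) in HK2; set (X3 := D s - D t - _) in HK3.
replace (A s - B s + D s - (A t - B t + D t)) with (X1 + (- X2 + X3)) by (unfold X1, X2, X3; ring).
apply Rle_trans with (1 := Cmod_triangle _ _).
apply Rle_trans with (1 := Rplus_le_compat_l _ _ _ (Cmod_triangle _ _)).
rewrite Cmod_opp; lra.
Qed.

(** * The jump across the pole *)

Lemma continuous_pair_derivable (f g : R -> R) (r : R) :
  ex_derive f r -> ex_derive g r ->
  continuous (U := C_UniformSpace) (fun r => (f r, g r)) r.
Proof.
intros [l Hl] [m Hm].
apply (ex_derive_continuous (K := R_AbsRing) (V := C_R_NormedModule)).
exists (l, m); now apply is_Rderive_pair.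
Qed.

(** In the limit the rays give - PI - 2 atan (c / s) and the third side - 2 atan (s / c). As atan (c
    / s) + atan (s / c) = PI / 2, the opening of the triangle drops out. *)
Lemma winding_limit (rho c s : R) : (0 < rho)%R -> (0 < c)%R -> (0 < s)%R ->
  forall eta : R, (0 < eta)%R -> exists R0 : R, forall R : R, (R0 < R)%R ->
    (Rabs (- 2 * (atan ((R - rho * c) / (rho * s)) + atan (c / s)) +
       2 * atan (R * s / (rho - R * c)) + 2 * PI) < eta)%R.
Proof.
intros Hr Hc Hs eta He.
(* In h = 1 / R, and with the argument that diverges inverted, the sum without its term 2 PI is
   continuous at h = 0. *)
set (f := fun h : R => (- 2 * (PI / 2 - atan (rho * s * h / (1 - rho * c * h)) + atan (c / s)) +
       2 * atan (s / (rho * h - c)))%R).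
assert (Hf0 : f 0%R = (- 2 * PI)%R).
{ unfold f; rewrite 3!Rmult_0_r, Rdiv_0_l, atan_0, Rminus_0_l.
  replace (s / - c)%R with (- / (c / s))%R by (field; lra).
  rewrite atan_opp, atan_inv by (apply Rdiv_lt_0_compat; lra); lra. }
assert (Hf : continuous f 0%R).
{ apply (ex_derive_continuous f); unfold f; auto_derive.
  repeat split; lra. }
destruct (proj1 (filterlim_locally f (f 0%R)) Hf (mkposreal eta He)) as [[d Hd] HH].
exists (Rmax (rho * c) (/ d)); intros R HR.
assert (H1 := Rle_lt_trans _ _ _ (Rmax_l _ _) HR).
assert (H2 := Rle_lt_trans _ _ _ (Rmax_r _ _) HR).
assert (HR0 : (0 < R)%R) by nra.
specialize (HH (/ R)%R).
assert (Hb : ball 0%R (mkposreal d Hd) (/ R)%R).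
{ change (Rabs (/ R - 0) < d)%R; rewrite Rminus_0_r, Rabs_right.
  - rewrite <- (Rinv_inv d); apply Rinv_lt_contravar; [|easy].
    apply Rmult_lt_0_compat; [now apply Rinv_0_lt_compat|easy].
  - now apply Rle_ge, Rlt_le, Rinv_0_lt_compat. }
specialize (HH Hb); change (Rabs (f (/ R)%R - f 0%R) < eta)%R in HH.
rewrite Hf0 in HH; unfold f in HH.
replace (rho * s * / R / (1 - rho * c * / R))%R with (/ ((R - rho * c) / (rho * s)))%R in HH
  by (field; repeat split; nra).
rewrite atan_inv in HH by (apply Rdiv_lt_0_compat; nra).
(* The threshold allows R c = rho. Both quotients then divide by 0 and are 0 by the convention of
   [Rinv], so they still agree. *)
destruct (Req_dec (rho - R * c) 0) as [E0|E0].
2: replace (s / (rho * / R - c))%R with (R * s / (rho - R * c))%R in HH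
  by (field; repeat split; nra).
2: { match goal with |- (Rabs ?a < _)%R => match type of HH with (Rabs ?b < _)%R =>
       replace a with b by ring end end; exact HH. }
replace (rho * / R - c)%R with 0%R in HH by (field_simplify_eq; lra).
rewrite E0; unfold Rdiv in *; rewrite Rinv_0, Rmult_0_r in *.
match goal with |- (Rabs ?a < _)%R => match type of HH with (Rabs ?b < _)%R =>
       replace a with b by ring end end; exact HH.
Qed.

Lemma pole_integrand_0 (y g a d : C) (r : R) :
  pole_integrand y g a d 0 r = d / (g - (a + RtoC r * d)).
Proof. unfold pole_integrand; rewrite 2!Cmult_0_l, Cexp_0; unfold Cdiv; ring. Qed.

Lemma is_RIntC_unique (f : R -> C) (a b : R) (l l' : C) :
  is_RIntC f a b l -> is_RIntC f a b l' -> l = l'.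
Proof.
intros H H'.
rewrite <- (is_RInt_unique (V := C_R_CompleteNormedModule) _ _ _ _ H).
exact (is_RInt_unique (V := C_R_CompleteNormedModule) _ _ _ _ H').
Qed.

Section Jump.

Variables (x : C) (rho theta eps : R).
Hypothesis rho_pos : (0 < rho)%R.
Hypothesis eps_bounds : (0 < eps < PI / 2)%R.

Let c := cos eps.
Let s := sin eps.
Let e := Cexpi theta.
(** [u1] and [u2] are the directions theta - eps and theta + eps in coordinates relative to [e]; the
    pole [g] lies on the axis between them. *)
Let u1 := e * (RtoC c - Ci * RtoC s).
Let u2 := e * (RtoC c + Ci * RtoC s).
Let g := RtoC rho * e.

Hypothesis Hx1 : (0 < Re (x * u1))%R.
Hypothesis Hx2 : (0 < Re (x * u2))%R.

Lemma c_pos : (0 < c)%R.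
Proof. apply cos_gt_0; lra. Qed.

Lemma s_pos : (0 < s)%R.
Proof. apply sin_gt_0; pose proof PI_RGT_0; lra. Qed.

Lemma c2_s2 : (c * c + s * s = 1)%R.
Proof. pose proof (sin2_cos2 eps); unfold Rsqr in *; unfold c, s; lra. Qed.

(** The squared distance from the pole to the point at parameter r of either ray; it is the common
    denominator of the two integrands at t = 0. *)
Lemma ray_factors (r : R) :
  (RtoC rho - RtoC r * (RtoC c - Ci * RtoC s)) * (RtoC rho - RtoC r * (RtoC c + Ci * RtoC s)) =
  RtoC ((r - rho * c) * (r - rho * c) + (rho * s) * (rho * s)).
Proof.
apply injective_projections; simpl; [|ring].
match goal with |- _ = ?D =>
  transitivity (D + (r * r - rho * rho) * (c * c + s * s - 1))%R; [ring|] end.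
rewrite c2_s2; ring.
Qed.

Lemma ray_factors_pos (r : R) :
  (0 < (r - rho * c) * (r - rho * c) + (rho * s) * (rho * s))%R.
Proof.
assert (0 < rho * s)%R by (apply Rmult_lt_0_compat; [easy|apply s_pos]).
pose proof (Rle_0_sqr (r - rho * c)); unfold Rsqr in *; nra.
Qed.

Lemma ray_factors_neq_0 (r : R) :
  RtoC rho - RtoC r * (RtoC c - Ci * RtoC s) <> 0 /\
  RtoC rho - RtoC r * (RtoC c + Ci * RtoC s) <> 0.
Proof.
assert (H : RtoC ((r - rho * c) * (r - rho * c) + (rho * s) * (rho * s)) <> 0).
{ intros H; apply RtoC_inj in H; pose proof (ray_factors_pos r); lra. }
rewrite <- ray_factors in H; split; intros H0; apply H; rewrite H0; ring.
Qed.

Lemma ray1_neq_0 (r : R) : g - (0 + RtoC r * u1) <> 0.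
Proof.
replace (g - (0 + RtoC r * u1)) with (e * (RtoC rho - RtoC r * (RtoC c - Ci * RtoC s)))
  by (unfold g, u1; ring).
apply Cmult_neq_0; [apply Cexpi_neq_0|apply ray_factors_neq_0].
Qed.

Lemma ray2_neq_0 (r : R) : g - (0 + RtoC r * u2) <> 0.
Proof.
replace (g - (0 + RtoC r * u2)) with (e * (RtoC rho - RtoC r * (RtoC c + Ci * RtoC s)))
  by (unfold g, u2; ring).
apply Cmult_neq_0; [apply Cexpi_neq_0|apply ray_factors_neq_0].
Qed.

(** In the frame of [e] the third side is a vertical segment at abscissa l c, symmetric about the
    axis that carries the pole. *)
Lemma third_side (l r : R) :
  g - (RtoC l * u1 + RtoC r * (e * Ci)) = e * (RtoC (rho - l * c) + Ci * RtoC (l * s - r)).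
Proof. unfold g, u1; rewrite 2!RtoC_minus, 2!RtoC_mult; ring. Qed.

Lemma Cmod_third_side_ge (l r : R) :
  (Rabs (rho - l * c) <= Cmod (g - (RtoC l * u1 + RtoC r * (e * Ci))))%R.
Proof.
rewrite third_side, Cmod_mult; unfold e; rewrite Cmod_Cexpi, Rmult_1_l.
apply Rle_trans with (2 := re_le_Cmod _); right; f_equal; unfold Re; simpl; ring.
Qed.

(** The two integrands at t = 0 are complex conjugates, so their difference is purely imaginary,
    with an arctangent as primitive. *)
Lemma rays_integral_0 (l : R) (A B : C) : (0 <= l)%R ->
  is_RIntC (pole_integrand x g 0 u1 0) 0 l A ->
  is_RIntC (pole_integrand x g 0 u2 0) 0 l B ->
  A - B = (0%R, (- 2 * (atan ((l - rho * c) / (rho * s)) + atan (c / s)))%R).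
Proof.
intros Hl HA HB.
assert (H := is_RInt_minus (V := C_R_NormedModule) _ _ _ _ _ _ HA HB).
assert (Hs := s_pos).
set (F := fun r : R => (0%R, (- 2 * atan ((r - rho * c) / (rho * s)))%R) : C).
assert (H' : is_RIntC (fun r : R => (0%R, (- 2 * (rho * s /
    ((r - rho * c) * (r - rho * c) + (rho * s) * (rho * s))))%R) : C) 0 l (F l - F 0%R)).
{ apply is_RIntC_derive; [easy| |].
  - intros r _; apply is_Rderive_pair; auto_derive; trivial.
    assert (Hp := ray_factors_pos r).
    field; repeat split; try lra.
  - intros r _; assert (Hp := ray_factors_pos r).
    apply continuous_pair_derivable; auto_derive; trivial; lra. }
assert (E : A - B = F l - F 0%R).
{ apply (is_RIntC_unique _ _ _ _ _ H).
  revert H'; apply is_RIntC_ext; [easy|]; intros r _.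
  match goal with |- _ = minus ?U ?V => change (minus U V) with (U - V) end.
  rewrite 2!pole_integrand_0.
  destruct (ray_factors_neq_0 r) as [N1 N2].
  assert (HD := ray_factors r); set (D := (_ + _)%R) in *.
  assert (HD0 : RtoC D <> 0) by (rewrite <- HD; now apply Cmult_neq_0).
  assert (He : e <> 0) by apply Cexpi_neq_0.
  transitivity (- (1 + 1) * Ci * RtoC rho * RtoC s / RtoC D).
  { transitivity (Ci * RtoC (- 2 * (rho * s / D))).
    - apply injective_projections; simpl; ring.
    - assert (D <> 0%R) by (intros H0; apply HD0; now rewrite H0).
      unfold Rdiv; rewrite 3!RtoC_mult, RtoC_inv by easy.
      replace (RtoC (-2)) with (- (1 + 1)) by (apply injective_projections; simpl; ring).
      field; easy. }
  rewrite <- HD.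
  replace (g - (0 + RtoC r * u1)) with (e * (RtoC rho - RtoC r * (RtoC c - Ci * RtoC s)))
    by (unfold g, u1; ring).
  replace (g - (0 + RtoC r * u2)) with (e * (RtoC rho - RtoC r * (RtoC c + Ci * RtoC s)))
    by (unfold g, u2; ring).
  unfold u1, u2; field; repeat split; easy. }
rewrite E; unfold F.
apply injective_projections; simpl; [ring|].
replace ((0 - rho * c) / (rho * s))%R with (- (c / s))%R by (field; lra).
rewrite atan_opp; ring.
Qed.
(** The logarithm in the primitive is even about the midpoint r = l s and cancels between the ends;
    only the arctangent survives. *)
Lemma third_integral_0 (l : R) (D : C) : (0 <= l)%R -> (rho - l * c <> 0)%R ->
  is_RIntC (pole_integrand x g (RtoC l * u1) (e * Ci) 0) 0 (2 * l * s) D ->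
  D = (0%R, (2 * atan (l * s / (rho - l * c)))%R).
Proof.
intros Hl HA HD.
assert (Hs := s_pos).
set (A := (rho - l * c)%R) in *.
assert (HA2 : (0 < A * A)%R) by nra.
set (F := fun r : R => ((- / 2 * ln (A * A + (l * s - r) * (l * s - r)))%R,
  (- atan ((l * s - r) / A))%R) : C).
assert (Hp : forall r, (0 < A * A + (l * s - r) * (l * s - r))%R).
{ intros r; pose proof (Rle_0_sqr (l * s - r)); unfold Rsqr in *; lra. }
assert (H' : is_RIntC (fun r : R =>
   (((l * s - r) / (A * A + (l * s - r) * (l * s - r)))%R,
    (A / (A * A + (l * s - r) * (l * s - r)))%R) : C) 0 (2 * l * s) (F (2 * l * s)%R - F 0%R)).
{ apply is_RIntC_derive; [nra| |].
  - intros r _; specialize (Hp r); apply is_Rderive_pair; auto_derive; trivial.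
    + field; lra.
    + field; lra.
  - intros r _; specialize (Hp r).
    apply continuous_pair_derivable; auto_derive; lra. }
assert (E : D = F (2 * l * s)%R - F 0%R).
{ apply (is_RIntC_unique _ _ _ _ _ HD).
  revert H'; apply is_RIntC_ext; [nra|]; intros r _.
  rewrite pole_integrand_0, third_side; fold A.
  specialize (Hp r); set (t := (l * s - r)%R) in *.
  assert (HN : RtoC A + Ci * RtoC t <> 0).
  { intros H0; apply HA; apply (f_equal Re) in H0.
    unfold Re in H0; simpl in H0; lra. }
  assert (HD0 : RtoC (A * A + t * t) <> 0) by (intros H0; apply RtoC_inj in H0; lra).
  transitivity (Ci * (RtoC A - Ci * RtoC t) / RtoC (A * A + t * t)).
  - unfold Cdiv; rewrite <- RtoC_inv by lra.
    apply injective_projections; simpl; field; lra.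
  - replace (RtoC (A * A + t * t)) with ((RtoC A + Ci * RtoC t) * (RtoC A - Ci * RtoC t)) in *
      by (apply injective_projections; simpl; ring).
    assert (He : e <> 0) by apply Cexpi_neq_0.
    assert (RtoC A - Ci * RtoC t <> 0) by (intros H0; apply HD0; rewrite H0; ring).
    field; repeat split; easy. }
rewrite E; unfold F.
replace (l * s - 2 * l * s)%R with (- (l * s))%R by ring.
rewrite Rminus_0_r.
apply injective_projections; simpl.
- replace (- (l * s) * - (l * s))%R with (l * s * (l * s))%R by ring; ring.
- replace (- (l * s) / A)%R with (- (l * s / A))%R by (field; lra).
  rewrite atan_opp; ring.
Qed.

(** Each point p of the side is l times a convex combination of u1 and u2, so Re (x p) is at least l
    times the smaller rate, while rho + 1 <= l c keeps the side at distance at least 1 from the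
    pole. *)
Lemma Cmod_third_integral_le (l : R) (D : C) : (0 <= l)%R -> (rho + 1 <= l * c)%R ->
  is_RIntC (pole_integrand x g (RtoC l * u1) (e * Ci) 1) 0 (2 * l * s) D ->
  (Cmod D <= 2 * l * s * exp (Re (x * g) - l * Rmin (Re (x * u1)) (Re (x * u2))))%R.
Proof.
intros Hl HA HD.
assert (Hs := s_pos).
set (d := Rmin (Re (x * u1)) (Re (x * u2))).
replace (2 * l * s)%R with (2 * l * s - 0)%R at 1 by ring.
refine (Cmod_RInt_le_const _ _ _ _ _ _ _ HD); [nra|].
intros r Hr; unfold pole_integrand.
set (q := g - (RtoC l * u1 + RtoC r * (e * Ci))).
assert (Hq : (1 <= Cmod q)%R).
{ apply Rle_trans with (2 := Cmod_third_side_ge l r).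
  rewrite <- Rabs_Ropp; apply Rle_trans with (2 := Rle_abs _); lra. }
assert (Hq0 : q <> 0) by (apply Cmod_gt_0; lra).
rewrite Cmod_mult, Cmod_mult, Cmod_Ci, Cmod_div, Cmod_Cexp by easy.
unfold e at 1; rewrite Cmod_Cexpi, 2!Rmult_1_l.
(* As u2 - u1 = 2 i s e, the point at parameter r is (l - t) u1 + t u2. *)
set (t := (r / (2 * s))%R).
assert (Ht : (0 <= t <= l)%R).
{ unfold t; split; [apply Rdiv_le_0_compat; lra|apply Rle_div_l; lra]. }
assert (Hre : (Re (RtoC 1 * x * q) <= Re (x * g) - l * d)%R).
{ replace (RtoC 1 * x * q) with (x * g + - (RtoC (l - t) * (x * u1) + RtoC t * (x * u2))).
  - rewrite Re_plus, Re_opp, Re_plus, 2!Re_scal.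
    assert (d <= Re (x * u1))%R by apply Rmin_l.
    assert (d <= Re (x * u2))%R by apply Rmin_r.
    nra.
  - unfold q; replace (RtoC r) with (RtoC t * (1 + 1) * RtoC s).
    + unfold u1, u2; rewrite RtoC_minus; ring.
    + unfold t; apply injective_projections; simpl; field; lra. }
apply Rle_div_l; [lra|].
apply Rle_trans with (1 := exp_le _ _ Hre).
rewrite <- (Rmult_1_r (exp _)) at 1.
apply Rmult_le_compat_l; [apply Rlt_le, exp_pos|easy].
Qed.

(** - 2 pi i is the integral of dp / (g - p) over a positively oriented loop around g. The length l
    is taken so large that the pole is inside the triangle and that the winding defect and the third
    side at t = 1 are each below eta / 2. *)
Lemma is_RInt_ray_pole_jump :
  is_RInt_ray (fun r => pole_integrand x g 0 u1 1 r - pole_integrand x g 0 u2 1 r)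
    (- (2 * RtoC PI * Ci)).
Proof.
assert (Hs := s_pos). assert (Hc := c_pos).
apply is_RInt_ray_intro; intros eta He.
set (d := Rmin (Re (x * u1)) (Re (x * u2))).
assert (Hd : (0 < d)%R) by now apply Rmin_pos.
set (K := (2 * s * exp (Re (x * g)))%R).
assert (HK : (0 < K)%R) by (unfold K; pose proof (exp_pos (Re (x * g))); nra).
destruct (winding_limit rho c s rho_pos Hc Hs (eta / 2) ltac:(lra)) as [R1 HR1].
destruct (pow_exp_decay_lt 1 d (eta / 2 / K) Hd) as [R2 HR2].
{ apply Rdiv_lt_0_compat; lra. }
exists (Rmax ((rho + 1) / c) (Rmax R1 R2)); intros l Hl.
assert (H0 := Rle_lt_trans _ _ _ (Rmax_l _ _) Hl).
assert (H1 := Rle_lt_trans _ _ _ (Rle_trans _ _ _ (Rmax_l _ _) (Rmax_r _ _)) Hl).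
assert (H2 := Rle_lt_trans _ _ _ (Rle_trans _ _ _ (Rmax_r _ _) (Rmax_r _ _)) Hl).
apply (proj1 (Rlt_div_l _ _ _ Hc)) in H0.
assert (Hl0 : (0 < l)%R) by nra.
destruct (triangle_pole_integral x g u1 u2 (e * Ci) l (2 * l * s)) as [T [HT ET]].
{ lra. }
{ nra. }
{ unfold u1, u2; rewrite 2!RtoC_mult.
  replace (RtoC 2) with (1 + 1) by (apply injective_projections; simpl; ring); ring. }
{ intros r _; apply ray1_neq_0. }
{ intros r _; apply ray2_neq_0. }
{ intros r _; apply Cmod_gt_0, Rlt_le_trans with (2 := Cmod_third_side_ge l r).
  apply Rabs_pos_lt; lra. }
destruct (HT 1%R) as [A1 [B1 D1]]; destruct (HT 0%R) as [A0 [B0 D0]].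
exists (fst (fst (T 1%R)) - snd (fst (T 1%R))); split.
{ exact (is_RInt_minus (V := C_R_NormedModule) _ _ _ _ _ _ A1 B1). }
assert (E0 := rays_integral_0 l _ _ (Rlt_le _ _ Hl0) A0 B0).
assert (F0 := third_integral_0 l _ (Rlt_le _ _ Hl0) ltac:(lra) D0).
assert (F1 := Cmod_third_integral_le l _ (Rlt_le _ _ Hl0) ltac:(lra) D1); fold d in F1.
rewrite E0, F0 in ET.
specialize (HR1 l H1); specialize (HR2 l H2).
set (w := (- 2 * (atan ((l - rho * c) / (rho * s)) + atan (c / s)) +
       2 * atan (l * s / (rho - l * c)) + 2 * PI)%R) in *.
match goal with |- (Cmod ?z < _)%R =>
  replace z with
    ((fst (fst (T 1%R)) - snd (fst (T 1%R)) + snd (T 1%R)) + 2 * RtoC PI * Ci - snd (T 1%R)) by ring end.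
rewrite ET.
match goal with |- (Cmod (?z - _)%C < _)%R =>
  replace z with (Ci * RtoC w) by (apply injective_projections; simpl; unfold w; ring) end.
unfold Cminus; apply Rle_lt_trans with (1 := Cmod_triangle _ _).
rewrite Cmod_opp, Cmod_mult, Cmod_Ci, Rmult_1_l, Cmod_R.
assert (HF : (2 * l * s * exp (Re (x * g) - l * d) < eta / 2)%R).
{ replace (Re (x * g) - l * d)%R with (Re (x * g) + - (d * l))%R by ring.
  rewrite exp_plus.
  replace (2 * l * s * (exp (Re (x * g)) * exp (- (d * l))))%R
    with (l ^ 1 * exp (- (d * l)) * K)%R by (unfold K; ring).
  now apply (Rlt_div_r _ _ K). }
lra.
Qed.

(** Rests on e^{-xp} / (1 - p / g) = g e^{-xg} e^{x (g - p)} / (g - p). *)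
Lemma is_RInt_ray_jump (K1 K2 : C) :
  is_RInt_ray (fun r => Cexp (- (x * (RtoC r * u1))) * (/ (1 - RtoC r * u1 / g) * u1)) K1 ->
  is_RInt_ray (fun r => Cexp (- (x * (RtoC r * u2))) * (/ (1 - RtoC r * u2 / g) * u2)) K2 ->
  K1 - K2 = - (2 * RtoC PI * Ci * g * Cexp (- (x * g))).
Proof.
intros H1 H2.
assert (Hg : g <> 0).
{ unfold g; apply Cmult_neq_0; [|apply Cexpi_neq_0].
  intros H; apply RtoC_inj in H; lra. }
apply (is_RInt_ray_unique _ _ _ (is_RInt_ray_minus _ _ _ _ H1 H2)).
replace (- (2 * RtoC PI * Ci * g * Cexp (- (x * g)))) with
  (g * Cexp (- (x * g)) * (- (2 * RtoC PI * Ci))) by ring.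
generalize (is_RInt_ray_scal _ (g * Cexp (- (x * g))) _ is_RInt_ray_pole_jump).
apply is_RInt_ray_ext; intros r _; unfold pole_integrand.
assert (Q : forall u, g - (0 + RtoC r * u) <> 0 ->
  g * Cexp (- (x * g)) * (u * (Cexp (RtoC 1 * x * (g - (0 + RtoC r * u))) /
    (g - (0 + RtoC r * u)))) =
  Cexp (- (x * (RtoC r * u))) * (/ (1 - RtoC r * u / g) * u)).
{ intros u Hu; set (q := g - (0 + RtoC r * u)) in *.
  replace (- (x * (RtoC r * u))) with (- (x * g) + RtoC 1 * x * q) by (unfold q; ring).
  rewrite Cexp_add.
  replace (1 - RtoC r * u / g) with (q / g) by (unfold q; field; easy).
  clearbody q g.
  field; easy. }
rewrite <- (Q u1), <- (Q u2) by (apply ray1_neq_0 || apply ray2_neq_0); ring.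
Qed.

End Jump.

(** * The Stokes matrix *)

(* [p^(k+1) / (1 - p / g) = g (p^k / (1 - p / g) - p^k)], integrated against the
   Laplace kernel. *)
Fixpoint pole_moment (g x T0 : C) (k : nat) : C :=
  match k with
  | O => T0
  | S j => g * (pole_moment g x T0 j - RtoC (INR (fact j)) / x ^ S j)
  end.

Lemma is_RInt_ray_pole_moment (g x u T0 : C) (k : nat) :
  g <> 0 -> Cmod u = 1%R -> (0 < Re (x * u))%R ->
  (forall r : R, (0 <= r)%R -> 1 - RtoC r * u / g <> 0) ->
  is_RInt_ray (fun r => Cexp (- (x * (RtoC r * u))) * (/ (1 - RtoC r * u / g) * u)) T0 ->
  is_RInt_ray (fun r => (RtoC r * u) ^ k * Cexp (- (x * (RtoC r * u))) *
    (/ (1 - RtoC r * u / g) * u)) (pole_moment g x T0 k).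
Proof.
intros Hg Hu Hx H0 HT; induction k as [|k IH].
- revert HT; apply is_RInt_ray_ext; intros r _; simpl; ring.
- generalize (is_RInt_ray_scal _ g _
    (is_RInt_ray_minus _ _ _ _ IH (is_RInt_ray_moment x u k Hu Hx))).
  apply is_RInt_ray_ext; intros r Hr; specialize (H0 r Hr).
  rewrite (Cpow_S _ k).
  set (w := 1 - RtoC r * u / g) in *.
  replace (RtoC r * u * (RtoC r * u) ^ k) with (g * (1 - w) * (RtoC r * u) ^ k)
    by (unfold w; field; easy).
  generalize ((RtoC r * u) ^ k) (Cexp (- (x * (RtoC r * u)))); intros P Q.
  field; easy.
Qed.

Lemma pole_moment_minus (g x K1 K2 : C) (k : nat) :
  pole_moment g x K1 k - pole_moment g x K2 k = g ^ k * (K1 - K2).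
Proof.
induction k as [|k IH]; [simpl; ring|].
rewrite Cpow_S, <- Cmult_assoc, <- IH; simpl; ring.
Qed.

Lemma Csum_minus (a b : nat -> C) (n : nat) :
  Csum a n - Csum b n = Csum (fun k => a k - b k) n.
Proof.
induction n as [|n IH]; [now rewrite 3!Csum_0|].
rewrite 3!Csum_S, <- IH; ring.
Qed.

Lemma Cexpi_add_dir (theta eps : R) :
  Cexpi (theta + eps) = Cexpi theta * (RtoC (cos eps) + Ci * RtoC (sin eps)).
Proof.
rewrite Cexpi_add, (Cexpi_eq eps); f_equal.
apply injective_projections; simpl; ring.
Qed.

Lemma Cexpi_sub_dir (theta eps : R) :
  Cexpi (theta - eps) = Cexpi theta * (RtoC (cos eps) - Ci * RtoC (sin eps)).
Proof.
unfold Rminus; rewrite Cexpi_add_dir, cos_neg, sin_neg, RtoC_opp; ring.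
Qed.

(** Termwise integration with a weight bounded by 1 / m, where m bounds the denominator from below.
    [T] stays abstract: only its defining integral enters the jump. *)
Lemma omega_approx (b1 b2 g1 g2 : C) (alpha : R) (x : C) :
  g1 <> g2 -> ~ singular_direction_inf g1 g2 alpha ->
  (Cmod (b2 - b1) < Re (x * Cexpi alpha))%R ->
  exists (T : C) (K : R),
    is_RInt_ray (fun r => Cexp (- (x * (RtoC r * Cexpi alpha))) *
      (/ (1 - RtoC r * Cexpi alpha / (g2 - g1)) * Cexpi alpha)) T /\
    forall n : nat,
      (Cmod (omega b1 b2 g1 g2 alpha x -
        Csum (fun k => v_coeff (b2 - b1) k * pole_moment (g2 - g1) x T k) n)%C <= K / INR (S n))%R.
Proof.
intros Hg Hs Hx.
assert (Hu := Cmod_Cexpi alpha).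
assert (Hx0 : (0 < Re (x * Cexpi alpha))%R)
  by (apply Rle_lt_trans with (2 := Hx), Cmod_ge_0).
destruct (laplace_denominator_bound g1 g2 (Cexpi alpha)) as [m [Hm Hden]].
{ intros r Hr; apply Rlt_le in Hr; now apply not_singular_denominator. }
assert (Hden0 : forall r, (0 <= r)%R -> 1 - RtoC r * Cexpi alpha / (g2 - g1) <> 0).
{ intros r Hr; apply Cmod_gt_0, Rlt_le_trans with (1 := Hm), (Hden r Hr). }
assert (HW : forall r, (0 <= r)%R ->
  (Cmod (/ (1 - RtoC r * Cexpi alpha / (g2 - g1)) * Cexpi alpha)%C <= / m)%R).
{ intros r Hr; rewrite Cmod_mult, Hu, Rmult_1_r, Cmod_inv by now apply Hden0.
  apply Rinv_le_contravar; [easy|exact (Hden r Hr)]. }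
destruct (ex_laplace (fun r => / (1 - RtoC r * Cexpi alpha / (g2 - g1)) * Cexpi alpha) (/ m) 0
  (Cexpi alpha)) with (x := x) as [T HT]; [| |exact Hx0|].
{ intros r Hr; apply continuous_RC_mult; [|apply (continuous_const (V := C_UniformSpace))].
  apply (continuous_inv_denominator g1 g2); exact (Hden0 r Hr). }
{ intros r Hr; rewrite Rmult_0_l, exp_0, Rmult_1_r; now apply HW. }
assert (HT' : is_RInt_ray (fun r => Cexp (- (x * (RtoC r * Cexpi alpha))) *
      (/ (1 - RtoC r * Cexpi alpha / (g2 - g1)) * Cexpi alpha)) T).
{ revert HT; apply is_RInt_ray_ext; intros r _; apply Cmult_comm. }
exists T, (/ m / (Re (x * Cexpi alpha) - Cmod (b2 - b1)))%R; split; [easy|].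
intros n; apply (Cmod_v_integral_minus_sum_le b1 b2 x (Cexpi alpha) _ _ (/ m) _ n Hu Hx HW).
- intros k; apply is_RInt_ray_pole_moment; try easy.
  now apply Cminus_neq_0.
- generalize (is_RInt_ray_laplace_integrand b1 b2 g1 g2 alpha Hg Hs x Hx).
  apply is_RInt_ray_ext; intros r _.
  unfold laplace_integrand, laplace_denominator, Cdiv; ring.
Qed.

(** The denominator vanishes only at p = g2 - g1, which forces r to be its modulus. *)
Lemma singular_direction_inf_iff (g1 g2 : C) (theta : R) :
  singular_direction_inf g1 g2 theta <->
  g1 <> g2 /\ g2 - g1 = RtoC (Cmod (g2 - g1)) * Cexpi theta.
Proof.
split; intros [Hg H]; (split; [easy|]); assert (Hg0 := Cminus_neq_0 _ _ Hg).
- destruct H as [r [Hr H]]; unfold laplace_denominator in H.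
  assert (E : g2 - g1 = RtoC r * Cexpi theta).
  { replace (g2 - g1) with ((1 - RtoC r * Cexpi theta / (g2 - g1)) * (g2 - g1) + RtoC r * Cexpi theta)
      at 1 by (field; easy).
    rewrite H; ring. }
  rewrite E at 2; rewrite Cmod_mult, Cmod_Cexpi, Cmod_R, Rabs_right, Rmult_1_r by lra; exact E.
- exists (Cmod (g2 - g1)); split; [now apply Cmod_gt_0|].
  unfold laplace_denominator; rewrite <- H; field; easy.
Qed.

(** Two singular directions differ by an angle with e^{i eps} = 1. The condition on the sine serves
    both signs of eps. *)
Lemma not_singular_near (g1 g2 : C) (theta eps : R) :
  singular_direction_inf g1 g2 theta -> sin eps <> 0%R ->
  ~ singular_direction_inf g1 g2 (theta + eps).
Proof.
intros H1 Hs H2.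
apply singular_direction_inf_iff in H1; apply singular_direction_inf_iff in H2.
destruct H1 as [Hg H1], H2 as [_ H2].
assert (Hm : RtoC (Cmod (g2 - g1)) <> 0).
{ intros H; apply RtoC_inj, Cmod_eq_0 in H; now apply Cminus_neq_0 in Hg. }
rewrite H1 in H2 at 1; rewrite Cexpi_add in H2.
assert (E : Cexpi eps = 1).
{ assert (Ht := Cexpi_neq_0 theta).
  replace (Cexpi eps) with (RtoC (Cmod (g2 - g1)) * (Cexpi theta * Cexpi eps) /
    (RtoC (Cmod (g2 - g1)) * Cexpi theta)) by (field; easy).
  rewrite <- H2; field; easy. }
rewrite Cexpi_eq in E; apply (f_equal snd) in E; simpl in E; easy.
Qed.

Lemma omega_jump (b1 b2 g1 g2 : C) (theta eps : R) (x : C) :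
  singular_direction_inf g1 g2 theta -> (0 < eps < PI / 2)%R ->
  (Cmod (b2 - b1) < Re (x * Cexpi (theta + eps)))%R ->
  (Cmod (b2 - b1) < Re (x * Cexpi (theta - eps)))%R ->
  omega b1 b2 g1 g2 (theta - eps) x - omega b1 b2 g1 g2 (theta + eps) x =
  - (2 * RtoC PI * Ci * (g2 - g1) * Cexp (- (x * (g2 - g1)))) * v b1 b2 (g2 - g1).
Proof.
intros Hs Heps Hp Hm.
assert (Hse : (0 < sin eps)%R) by (apply sin_gt_0; pose proof PI_RGT_0; lra).
assert (Hsp : ~ singular_direction_inf g1 g2 (theta + eps)) by (apply not_singular_near; [easy|lra]).
assert (Hsm : ~ singular_direction_inf g1 g2 (theta - eps))
  by (apply not_singular_near; [easy|rewrite sin_neg; lra]).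
destruct (proj1 (singular_direction_inf_iff _ _ _) Hs) as [Hg E].
destruct (omega_approx b1 b2 g1 g2 _ x Hg Hsm Hm) as [T1 [K1 [HT1 HK1]]].
destruct (omega_approx b1 b2 g1 g2 _ x Hg Hsp Hp) as [T2 [K2 [HT2 HK2]]].
assert (Hbp := Cmod_ge_0 (b2 - b1)).
assert (J : T1 - T2 = - (2 * RtoC PI * Ci * (g2 - g1) * Cexp (- (x * (g2 - g1))))).
{ rewrite Cexpi_sub_dir in HT1, Hm; rewrite Cexpi_add_dir in HT2, Hp.
  assert (Hrho : (0 < Cmod (g2 - g1))%R) by now apply Cmod_gt_0, Cminus_neq_0.
  rewrite E; set (rho := Cmod (g2 - g1)) in *.
  rewrite E in HT1, HT2.
  apply (is_RInt_ray_jump x rho theta eps Hrho Heps); try easy; lra. }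
rewrite <- J.
match goal with |- ?a = ?b => assert (H0 : a - b = 0) end.
2: { match goal with |- ?a = ?b => replace a with (a - b + b) by ring end. rewrite H0; ring. }
(* Three errors of order 1 / (n + 1): one in each direction, and the tail of [v] at the pole, where
   |p| = |g2 - g1|. *)
apply (Cmod_eq_0_inv_nat _ (K1 + K2 + Cmod (T1 - T2) * exp (Cmod (b2 - b1) * Cmod (g2 - g1)))).
intros n; specialize (HK1 n); specialize (HK2 n).
assert (H3 := Cmod_v_minus_sum_le b1 b2 (g2 - g1) n).
set (S1 := Csum _ n) in HK1; set (S2 := Csum _ n) in HK2; set (S3 := Csum _ n) in H3.
assert (ES : S1 - S2 = S3 * (T1 - T2)).
{ unfold S1, S2, S3; rewrite Csum_minus, <- Csum_mult_r.
  apply Csum_ext; intros k.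
  rewrite <- (Cmult_assoc (v_coeff _ _)), <- (pole_moment_minus _ x); ring. }
set (o1 := omega _ _ _ _ (theta - eps) x) in *.
set (o2 := omega _ _ _ _ (theta + eps) x) in *.
replace (o1 - o2 - (T1 - T2) * v b1 b2 (g2 - g1)) with
  ((o1 - S1) + (- (o2 - S2) + - ((T1 - T2) * (v b1 b2 (g2 - g1) - S3)))).
2: { replace S1 with (S1 - S2 + S2) by ring; rewrite ES; ring. }
apply Rle_trans with (1 := Cmod_triangle _ _).
apply Rle_trans with (1 := Rplus_le_compat_l _ _ _ (Cmod_triangle _ _)).
rewrite 2!Cmod_opp, Cmod_mult, 2!Rdiv_plus_distr.
assert (H4 := Rmult_le_compat_l _ _ _ (Cmod_ge_0 (T1 - T2)) H3).
unfold Rdiv in *; rewrite <- Rmult_assoc in H4; lra.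
Qed.

Lemma is_inverse_upper (a p d : C) : a <> 0 -> d <> 0 ->
  is_inverse (mk22 a p 0 d) (mk22 (/ a) (- (p / (a * d))) 0 (/ d)).
Proof.
intros Ha Hd; split; rewrite mul22_mk22, one22_mk22; f_equal; field; easy.
Qed.

(** The two matrices share their diagonal, so the quotient is unipotent. Its corner entry is the
    jump of [omega] times e^{(g2 - g1) x}, which cancels the only dependence of the jump on x. *)
Lemma Phi_inf_stokes (b1 b2 g1 g2 : C) (theta eps : R) (x : C) :
  singular_direction_inf g1 g2 theta -> (0 < eps < PI / 2)%R ->
  dom_inf b1 b2 g1 g2 (theta + eps) x -> dom_inf b1 b2 g1 g2 (theta - eps) x ->
  exists N : C22,
    is_inverse (Phi_inf b1 b2 g1 g2 (theta + eps) x) N /\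
    mk22 1 (2 * RtoC PI * Ci * (g2 - g1) * - v b1 b2 (g2 - g1)) 0 1 =
    mul22 N (Phi_inf b1 b2 g1 g2 (theta - eps) x).
Proof.
intros Hs Heps Hp Hm.
assert (Hx := dom_inf_neq_0 _ _ _ _ _ _ Hp).
rewrite 2!Phi_inf_mk22.
assert (Ha : Cexp (- (b1 / x)) * Cexp (g1 * x) <> 0) by (apply Cmult_neq_0; apply Cexp_neq_0).
assert (Hd : Cexp (- (b2 / x)) * (1 / x) ^ 2 * Cexp (g2 * x) <> 0).
{ apply Cmult_neq_0; [apply Cmult_neq_0|]; try apply Cexp_neq_0.
  now apply inv_pow_neq_0. }
eexists; split; [now apply is_inverse_upper|].
rewrite mul22_mk22.
assert (J : P12_inf b1 b2 g1 g2 (theta - eps) x - P12_inf b1 b2 g1 g2 (theta + eps) x =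
  - (2 * RtoC PI * Ci * (g2 - g1) * Cexp (- (x * (g2 - g1)))) * v b1 b2 (g2 - g1)).
{ rewrite <- (omega_jump b1 b2 g1 g2 theta eps x Hs Heps).
  - unfold P12_inf; ring.
  - revert Hp; unfold dom_inf; destruct (Ceq_dec g1 g2) as [E|_]; [now apply (proj1 Hs) in E|easy].
  - revert Hm; unfold dom_inf; destruct (Ceq_dec g1 g2) as [E|_]; [now apply (proj1 Hs) in E|easy]. }
assert (Eg : Cexp (g1 * x) = Cexp (- (x * (g2 - g1))) * Cexp (g2 * x))
  by (rewrite <- Cexp_add; f_equal; ring).
assert (N1 := Cexp_neq_0 (- (b1 / x))). assert (N2 := Cexp_neq_0 (g1 * x)).
f_equal.
- set (d := _ * (1 / x) ^ 2 * _) in *; clearbody d; field; repeat split; easy.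
- transitivity ((P12_inf b1 b2 g1 g2 (theta - eps) x - P12_inf b1 b2 g1 g2 (theta + eps) x)
    * Cexp (g2 * x) / Cexp (g1 * x)).
  + rewrite J, Eg; field; split; apply Cexp_neq_0.
  + set (d := _ * (1 / x) ^ 2 * _) in *; clearbody d.
    set (P1 := P12_inf _ _ _ _ (theta - eps) x); set (P2 := P12_inf _ _ _ _ (theta + eps) x).
    field; repeat split; easy.
- ring.
- set (d := _ * (1 / x) ^ 2 * _) in *; clearbody d; field; easy.
Qed.

(** * Arguments, angles modulo 2 pi and the common domain *)

Lemma ex_arg (z : C) : z <> 0 -> exists theta : R, is_arg z theta.
Proof.
intros Hz.
assert (Hm : (0 < Cmod z)%R) by now apply Cmod_gt_0.
set (a := (Re z / Cmod z)%R). set (b := (Im z / Cmod z)%R).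
assert (Hab : (a * a + b * b = 1)%R).
{ assert (H := Cmod2_alt z); unfold a, b.
  replace (_ + _)%R with ((Re z ^ 2 + Im z ^ 2) / (Cmod z ^ 2))%R by (field; lra).
  rewrite <- H; field; lra. }
assert (Ha : (-1 <= a <= 1)%R) by nra.
assert (E : forall t, cos t = a -> sin t = b -> is_arg z t).
{ intros t Hc Hs; split; [easy|]; rewrite Cexpi_eq, Hc, Hs; unfold a, b.
  apply injective_projections; simpl; unfold Re, Im; field; lra. }
assert (Hs := sin_acos a Ha).
assert (Hsq : sqrt (1 - Rsqr a) = Rabs b).
{ rewrite <- sqrt_Rsqr_abs; f_equal; unfold Rsqr; lra. }
destruct (Rle_dec 0 b) as [Hb|Hb].
- exists (acos a); apply E; [now apply cos_acos|].
  rewrite Hs, Hsq; apply Rabs_right; lra.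
- exists (- acos a)%R; apply E; [rewrite cos_neg; now apply cos_acos|].
  rewrite sin_neg, Hs, Hsq, Rabs_left by lra; ring.
Qed.

Lemma Cexpi_eq_1_iff (t : R) : Cexpi t = 1 <-> exists k : Z, t = (2 * IZR k * PI)%R.
Proof.
rewrite Cexpi_eq; split.
- intros H; apply (f_equal fst) in H; simpl in H.
  replace t with (2 * (t / 2))%R in H by field.
  rewrite cos_2a_sin in H.
  assert (Hs : sin (t / 2) = 0%R) by nra.
  destruct (sin_eq_0_0 _ Hs) as [k Hk]; exists k; lra.
- intros [k ->].
  replace (2 * IZR k * PI)%R with (2 * (IZR k * PI))%R by ring.
  assert (Hs : sin (IZR k * PI) = 0%R) by (apply sin_eq_0_1; now exists k).
  rewrite cos_2a_sin, sin_2a, Hs; apply injective_projections; simpl; ring.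
Qed.

Lemma Cexpi_inj_mod (s t : R) : Cexpi s = Cexpi t <-> eq_mod_2PI s t.
Proof.
assert (E : Cexpi s = Cexpi (s - t) * Cexpi t)
  by (rewrite <- Cexpi_add; f_equal; ring).
split.
- intros H; rewrite E in H.
  assert (H1 : Cexpi (s - t) = 1).
  { assert (Ht := Cexpi_neq_0 t).
    replace (Cexpi (s - t)) with (Cexpi (s - t) * Cexpi t / Cexpi t) by (field; easy).
    rewrite H; field; easy. }
  destruct (proj1 (Cexpi_eq_1_iff _) H1) as [k Hk]; exists k; lra.
- intros [k Hk]; rewrite E.
  rewrite (proj2 (Cexpi_eq_1_iff (s - t))); [ring|exists k; lra].
Qed.

Lemma singular_direction_inf_arg (g1 g2 : C) : g1 <> g2 ->
  exists theta0 : R, is_arg (g2 - g1) theta0 /\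
    forall theta : R, singular_direction_inf g1 g2 theta <-> eq_mod_2PI theta theta0.
Proof.
intros Hg; assert (Hg0 := Cminus_neq_0 _ _ Hg).
destruct (ex_arg _ Hg0) as [t0 Ht0]; exists t0; split; [easy|]; intros t.
destruct Ht0 as [_ Ht0].
rewrite singular_direction_inf_iff, <- Cexpi_inj_mod; split.
- intros [_ H]; rewrite Ht0 in H at 1.
  assert (Hm : RtoC (Cmod (g2 - g1)) <> 0).
  { intros E; apply RtoC_inj, Cmod_eq_0 in E; easy. }
  replace (Cexpi t) with (RtoC (Cmod (g2 - g1)) * Cexpi t / RtoC (Cmod (g2 - g1))) by (field; easy).
  rewrite <- H; field; easy.
- intros ->; now split.
Qed.

Lemma dom_inf_common (b1 b2 g1 g2 : C) (theta eps : R) : g1 <> g2 -> (0 < eps < PI / 2)%R ->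
  exists x : C, dom_inf b1 b2 g1 g2 (theta + eps) x /\ dom_inf b1 b2 g1 g2 (theta - eps) x.
Proof.
intros Hg Heps.
assert (Hc : (0 < cos eps)%R) by (apply cos_gt_0; lra).
(* The point lies on the ray of angle - theta, scaled so that both real parts in question equal |b2
   - b1| + 1. *)
exists (RtoC ((Cmod (b2 - b1) + 1) / cos eps) * Cexpi (- theta)).
unfold dom_inf; destruct (Ceq_dec g1 g2); [easy|].
split; rewrite <- Cmult_assoc, <- Cexpi_add, Re_scal, Cexpi_eq; cbn [Re fst].
- replace (- theta + (theta + eps))%R with eps by ring.
  replace (_ / _ * _)%R with (Cmod (b2 - b1) + 1)%R by (field; lra); lra.
- replace (- theta + (theta - eps))%R with (- eps)%R by ring; rewrite cos_neg.
  replace (_ / _ * _)%R with (Cmod (b2 - b1) + 1)%R by (field; lra); lra.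
Qed.

Theorem theorem3p13 (b1 b2 g1 g2 : C) (hb : b1 <> b2) :
  (forall theta : R, ~ singular_direction_inf g1 g2 theta ->
     is_fundamental_matrix b1 b2 g1 g2 (dom_inf b1 b2 g1 g2 theta)
       (Phi_inf b1 b2 g1 g2 theta) /\
     (g1 <> g2 -> forall x : C, dom_inf b1 b2 g1 g2 theta x ->
        ex_RInt_gen (V := C_R_NormedModule)
          (laplace_integrand b1 b2 g1 g2 theta x)
          (at_point 0%R) (Rbar_locally p_infty))) /\
  (g1 <> g2 ->
     exists theta0 : R, is_arg (g2 - g1) theta0 /\
       forall theta : R,
         singular_direction_inf g1 g2 theta <-> eq_mod_2PI theta theta0) /\
  (exists S : C,
     is_series (V := C_NormedModule)
       (fun n : nat =>
          (- (1)) ^ (n + 1) * (g2 - g1) ^ n * (b2 - b1) ^ n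
          / RtoC (INR (fact n) * INR (fact (n + 1)))) S /\
     forall theta : R,
       (g1 <> g2 -> singular_direction_inf g1 g2 theta) ->
       is_stokes_matrix_inf b1 b2 g1 g2 theta
         (mk22 1 (2 * RtoC PI * Ci * (g2 - g1) * S) 0 1)).
Proof.
refine (conj _ (conj _ _)).
- intros theta Hs; split; [now apply Phi_inf_fundamental|].
  intros Hg x; unfold dom_inf; destruct (Ceq_dec g1 g2) as [|_]; [easy|]; intros Hx.
  exists (omega b1 b2 g1 g2 theta x); now apply is_RInt_ray_laplace_integrand.
- apply singular_direction_inf_arg.
(* The extra sign in (-1)^{n+1} is that of the residue. *)
- exists (- v b1 b2 (g2 - g1)); split.
  + generalize (is_series_opp (V := C_NormedModule) _ _ (is_series_v b1 b2 (g2 - g1))).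
    apply is_series_ext; intros n.
    change (- (v_coeff (b2 - b1) n * (g2 - g1) ^ n) =
      (- (1)) ^ (n + 1) * (g2 - g1) ^ n * (b2 - b1) ^ n / RtoC (INR (fact n) * INR (fact (n + 1)))).
    unfold v_coeff; rewrite Nat.add_1_r, Cpow_S; unfold Cdiv; ring.
  + intros theta Hs; split.
    * intros <-; rewrite one22_mk22; f_equal; ring.
    * intros Hg; specialize (Hs Hg).
      (* Below PI / 2, cos eps > 0 makes the two domains meet and sin eps > 0 makes both
         neighbouring directions nonsingular. *)
      exists (PI / 2)%R; split; [pose proof PI_RGT_0; lra|].
      intros eps Heps; split; [now apply dom_inf_common|].
      intros x [Hp Hm]; now apply Phi_inf_stokes.
Qed.
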